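(* Let $R$ be a commutative noetherian ring, let $C$ be a semidualizing $R$-module, let $M$ be a finitely generated $R$-module, let $N$ be an $R$-module, and let $F$ be a flat $R$-module. For all $i\geq 0$ there are isomorphisms $$\operatorname{Ext}^i_{\mathcal{M}\mathcal{I}_C}(M,N)\otimes_R F\cong\operatorname{Ext}^i_{\mathcal{M}\mathcal{I}_C}(M,N\otimes_R F),$$ $$\operatorname{Ext}^i_{\mathcal{P}_C\mathcal{M}}(M,N)\otimes_R F\cong\operatorname{Ext}^i_{\mathcal{P}_C\mathcal{M}}(M,N\otimes_R F).$$
   Context: $R$ is a commutative noetherian ring. A finitely generated $R$-module $C$ is semidualizing if the homothety map $R\to\operatorname{Hom}_R(C,C)$ is an isomorphism and $\operatorname{Ext}^i_R(C,C)=0$ for all $i\geq 1$. $\mathcal{P}_C(R)$ is the class of $R$-modules isomorphic to $P\otimes_R C$ with $P$ projective, and $\mathcal{I}_C(R)$ is the class of $R$-modules isomorphic to $\operatorname{Hom}_R(C,E)$ with $E$ injective; the first is precovering and the second is preenveloping. A proper $\mathcal{P}_C$-resolution of $M$ is a complex $L=(\cdots\to L_1\to L_0\to 0)$ of modules in $\mathcal{P}_C(R)$ with an augmentation $L_0\to M$ such that $L^+=(\cdots\to L_1\to L_0\to M\to 0)$ is a complex (not necessarily exact) and $\operatorname{Hom}_R(Y,L^+)$ is exact for all $Y\in\mathcal{P}_C(R)$. Dually, a proper $\mathcal{I}_C$-coresolution of $N$ is a complex $J=(0\to J^0\to J^1\to\cdots)$ of modules in $\mathcal{I}_C(R)$ with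 an augmentation $N\to J^0$ such that $J^+=(0\to N\to J^0\to J^1\to\cdots)$ is a complex and $\operatorname{Hom}_R(J^+,Y)$ is exact for all $Y\in\mathcal{I}_C(R)$. With $L$ a proper $\mathcal{P}_C$-resolution of $M$ and $J$ a proper $\mathcal{I}_C$-coresolution of $N$, set for each $i\geq 0$: $\operatorname{Ext}^i_{\mathcal{P}_C\mathcal{M}}(M,N):=H_{-i}(\operatorname{Hom}_R(L,N))$ and $\operatorname{Ext}^i_{\mathcal{M}\mathcal{I}_C}(M,N):=H_{-i}(\operatorname{Hom}_R(M,J))$ (the $i$-th cohomology). These are independent of choices. *)

(* Defs.v *)
From HB Require Import structures.
From mathcomp Require Import all_boot all_algebra.
From mathcomp Require Import boolp.

Set Implicit Arguments.
Unset Strict Implicit.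
Unset Printing Implicit Defensive.

Import GRing.Theory.
Local Open Scope ring_scope.
Local Open Scope quotient_scope.

Definition isomorphic (R : pzRingType) (U V : lmodType R) : Prop :=
  exists f : {linear U -> V}, bijective f.

Definition lin_comb (R : pzRingType) (V : lmodType R) (s : seq V) (x : V) : Prop :=
  exists a : 'I_(size s) -> R, x = \sum_i a i *: s`_i.

Definition fin_gen (R : pzRingType) (V : lmodType R) : Prop :=
  exists s : seq V, forall x, lin_comb s x.

(* The submodules of R^o are the ideals of R. *)
Definition noetherian (R : comPzRingType) : Prop :=
  forall I : {pred R^o}, submod_closed I ->
  exists s : seq R^o, forall x, x \in I <-> lin_comb s x.

(* An alias, so that its module structure does not clash with the instances
   that other libraries put on {linear U -> V}. *)
Definition hom (R : comPzRingType) (U V : lmodType R) : Type := {linear U -> V}.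

Section HomModule.
Variables (R : comPzRingType) (U V : lmodType R).
Implicit Types f g h : hom U V.

HB.instance Definition _ := gen_eqMixin (hom U V).
HB.instance Definition _ := gen_choiceMixin (hom U V).

Lemma hom_ext f g : (forall x, f x = g x) -> f = g.
Proof.
case: f g => [f [[f1] [f2]]] [g [[g1] [g2]]] /= fg.
have {}fg : f = g by exact: funext.
case: g / fg g1 g2 => g1 g2.
by rewrite (Prop_irrelevance f1 g1) (Prop_irrelevance f2 g2).
Qed.

Definition hom0 : hom U V := [the {linear U -> V} of \0].
Definition hom_opp f : hom U V := [the {linear U -> V} of \- f].
Definition hom_add f g : hom U V := [the {linear U -> V} of f \+ g].
Definition hom_scale (a : R) f : hom U V := [the {linear U -> V} of a \*: f].

Fact hom_addA : associative hom_add.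
Proof. by move=> f g h; apply: hom_ext => x /=; rewrite addrA. Qed.
Fact hom_addC : commutative hom_add.
Proof. by move=> f g; apply: hom_ext => x /=; rewrite addrC. Qed.
Fact hom_add0 : left_id hom0 hom_add.
Proof. by move=> f; apply: hom_ext => x /=; rewrite add0r. Qed.
Fact hom_addN : left_inverse hom0 hom_opp hom_add.
Proof. by move=> f; apply: hom_ext => x /=; rewrite addNr. Qed.
HB.instance Definition _ :=
  GRing.isZmodule.Build (hom U V) hom_addA hom_addC hom_add0 hom_addN.

Fact hom_scaleA a b f : hom_scale a (hom_scale b f) = hom_scale (a * b) f.
Proof. by apply: hom_ext => x /=; rewrite scalerA. Qed.
Fact hom_scale1 : left_id 1 hom_scale.
Proof. by move=> f; apply: hom_ext => x /=; rewrite scale1r. Qed.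
Fact hom_scaleDr : right_distributive hom_scale +%R.
Proof. by move=> a f g; apply: hom_ext => x /=; rewrite scalerDr. Qed.
Fact hom_scaleDl f : {morph hom_scale^~ f : a b / a + b}.
Proof. by move=> a b; apply: hom_ext => x /=; rewrite scalerDl. Qed.
HB.instance Definition _ :=
  GRing.Zmodule_isLmodule.Build R (hom U V) hom_scaleA hom_scale1
    hom_scaleDr hom_scaleDl.

Lemma homDE f g x : (f + g) x = f x + g x. Proof. by []. Qed.
Lemma homZE a f x : (a *: f) x = a *: f x. Proof. by []. Qed.
End HomModule.

Section HomMaps.
Variables (R : comPzRingType) (U V W : lmodType R).

Definition hom_post_fun (f : {linear V -> W}) (g : hom U V) : hom U W :=
  [the {linear U -> W} of f \o g].
Fact hom_post_linear f : linear (hom_post_fun f).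
Proof. by move=> a g h; apply: hom_ext => x /=; rewrite linearP. Qed.
HB.instance Definition _ f :=
  GRing.isLinear.Build R (hom U V) (hom U W) _ (hom_post_fun f)
    (hom_post_linear f).
Definition hom_post (f : {linear V -> W}) : {linear hom U V -> hom U W} :=
  hom_post_fun f.

Definition hom_pre_fun (f : {linear U -> V}) (g : hom V W) : hom U W :=
  [the {linear U -> W} of g \o f].
Fact hom_pre_linear f : linear (hom_pre_fun f).
Proof. by move=> a g h; apply: hom_ext. Qed.
HB.instance Definition _ f :=
  GRing.isLinear.Build R (hom V W) (hom U W) _ (hom_pre_fun f)
    (hom_pre_linear f).
Definition hom_pre (f : {linear U -> V}) : {linear hom V W -> hom U W} :=
  hom_pre_fun f.
End HomMaps.

Section QuotientModule.
Variables (R : pzRingType) (V : lmodType R) (S : {pred V}).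
Hypothesis subS : submod_closed S.

Definition quot_pred : zmodClosed V :=
  HB.pack_for (zmodClosed V) (S : V -> bool)
    (GRing.isZmodClosed.Build V S (GRing.submod_closedB subS)).

Definition quot_mod : Type := Quotient.quot quot_pred.
HB.instance Definition _ := GRing.Zmodule.on quot_mod.

Definition quot_proj_fun (x : V) : quot_mod := \pi_(Quotient.quot quot_pred) x.

Lemma quot_projP x y : quot_proj_fun x = quot_proj_fun y <-> x - y \in S.
Proof.
rewrite -[_ \in S]/(x - y \in quot_pred) Quotient.idealrBE.
by split=> [/eqP|/eqP].
Qed.

Lemma quot_proj_surj (q : quot_mod) : exists x, quot_proj_fun x = q.
Proof. by exists (repr (q : Quotient.quot quot_pred)); apply: reprK. Qed.

Fact quot_projD : {morph quot_proj_fun : x y / x + y}.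
Proof. exact: (raddfD \pi_(Quotient.quot quot_pred)). Qed.

Definition quot_scale (a : R) (q : quot_mod) : quot_mod :=
  quot_proj_fun (a *: repr (q : Quotient.quot quot_pred)).

Fact quot_projZ a x : quot_proj_fun (a *: x) = quot_scale a (quot_proj_fun x).
Proof.
apply/quot_projP; rewrite -scalerBr; apply: (GRing.submod_closed_semi subS).2.
by apply/quot_projP; rewrite /quot_proj_fun reprK.
Qed.

Fact quot_scaleA a b q : quot_scale a (quot_scale b q) = quot_scale (a * b) q.
Proof. by case: (quot_proj_surj q) => x <-; rewrite -!quot_projZ scalerA. Qed.
Fact quot_scale1 : left_id 1 quot_scale.
Proof. by move=> q; case: (quot_proj_surj q) => x <-; rewrite -quot_projZ scale1r. Qed.
Fact quot_scaleDr : right_distributive quot_scale +%R.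
Proof.
move=> a p q; case: (quot_proj_surj p) (quot_proj_surj q) => [x <-] [y <-].
by rewrite -quot_projD -!quot_projZ scalerDr quot_projD.
Qed.
Fact quot_scaleDl q : {morph quot_scale^~ q : a b / a + b}.
Proof.
move=> a b; case: (quot_proj_surj q) => x <-.
by rewrite -!quot_projZ scalerDl quot_projD.
Qed.
HB.instance Definition _ :=
  GRing.Zmodule_isLmodule.Build R quot_mod quot_scaleA quot_scale1
    quot_scaleDr quot_scaleDl.

Fact quot_proj_linear : linear quot_proj_fun.
Proof. by move=> a x y; rewrite quot_projD quot_projZ. Qed.
HB.instance Definition _ :=
  GRing.isLinear.Build R V quot_mod _ quot_proj_fun quot_proj_linear.
Definition quot_proj : {linear V -> quot_mod} := quot_proj_fun.
End QuotientModule.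

(* [:: (a1, b1); ..; (an, bn)] stands for the formal sum of the ai (x) bi.
   No clause for opposites is needed: (-1) *: a gives them. *)
Inductive tensor_rel (R : comPzRingType) (A B : lmodType R) :
  seq (A * B) -> seq (A * B) -> Prop :=
| tensor_refl s : tensor_rel s s
| tensor_sym s t : tensor_rel s t -> tensor_rel t s
| tensor_trans s t u : tensor_rel s t -> tensor_rel t u -> tensor_rel s u
| tensor_cat s s' t t' :
    tensor_rel s s' -> tensor_rel t t' -> tensor_rel (s ++ t) (s' ++ t')
| tensor_comm s t : tensor_rel (s ++ t) (t ++ s)
| tensor_zero b : tensor_rel [:: (0, b)] [::]
| tensor_addl a a' b : tensor_rel [:: (a + a', b)] [:: (a, b); (a', b)]
| tensor_addr a b b' : tensor_rel [:: (a, b + b')] [:: (a, b); (a, b')]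
| tensor_scale r a b : tensor_rel [:: (r *: a, b)] [:: (a, r *: b)].

Arguments tensor_refl {R A B} s.
Arguments tensor_comm {R A B} s t.
Arguments tensor_zero {R A B} b.
Arguments tensor_addl {R A B} a a' b.
Arguments tensor_addr {R A B} a b b'.
Arguments tensor_scale {R A B} r a b.

Section Tensor.
Variables (R : comPzRingType) (A B : lmodType R).
Implicit Types s t : seq (A * B).

Definition tensor_relb s t : bool := `[< tensor_rel s t >].

Fact tensor_relb_equiv : equiv_class_of tensor_relb.
Proof.
split=> [s|s t|t s u]; first exact/asboolP/tensor_refl.
  by apply/asboolP/asboolP; apply: tensor_sym.
by move=> /asboolP st /asboolP tu; apply/asboolP/(tensor_trans st tu).
Qed.
Canonical tensor_relb_equivRel := EquivRelPack tensor_relb_equiv.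

Definition tensor : Type := {eq_quot tensor_relb}.
HB.instance Definition _ := Choice.on tensor.

Definition tensor_pi s : tensor := \pi_({eq_quot tensor_relb}) s.
Definition tensor_repr (x : tensor) : seq (A * B) :=
  repr (x : {eq_quot tensor_relb}).

Lemma tensor_reprK x : tensor_pi (tensor_repr x) = x.
Proof. exact: reprK. Qed.

Lemma tensor_piP s t : tensor_pi s = tensor_pi t <-> tensor_rel s t.
Proof.
split=> [/eqquotP/asboolP//|st].
exact/eqquotP/asboolP.
Qed.

Lemma tensor_pi_surj x : exists s, tensor_pi s = x.
Proof. by exists (tensor_repr x); apply: tensor_reprK. Qed.

Definition scale_seq (r : R) s : seq (A * B) := [seq (r *: p.1, p.2) | p <- s].

Fact tensor_rel_scale r s t :
  tensor_rel s t -> tensor_rel (scale_seq r s) (scale_seq r t).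
Proof.
elim=> {s t} [s|s t _ IH|s t u _ IH1 _ IH2|s s' t t' _ IH1 _ IH2|s t|b|a a' b|a b b'|k a b] /=.
- exact: tensor_refl.
- exact: tensor_sym.
- exact: tensor_trans IH1 IH2.
- by rewrite /scale_seq !map_cat; apply: tensor_cat.
- by rewrite /scale_seq !map_cat; apply: tensor_comm.
- by rewrite scaler0; apply: tensor_zero.
- by rewrite scalerDr; apply: tensor_addl.
- exact: tensor_addr.
- by rewrite scalerA mulrC -scalerA; apply: tensor_scale.
Qed.

Definition tensor0 : tensor := tensor_pi [::].
Definition tensor_add (x y : tensor) : tensor :=
  tensor_pi (tensor_repr x ++ tensor_repr y).
Definition tensor_scl (r : R) (x : tensor) : tensor :=
  tensor_pi (scale_seq r (tensor_repr x)).
Definition tensor_opp (x : tensor) : tensor := tensor_scl (-1) x.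

Fact tensor_pi_cat s t : tensor_pi (s ++ t) = tensor_add (tensor_pi s) (tensor_pi t).
Proof. by apply/tensor_piP/tensor_cat; apply/tensor_piP; rewrite tensor_reprK. Qed.

Fact tensor_pi_scl r s : tensor_pi (scale_seq r s) = tensor_scl r (tensor_pi s).
Proof. by apply/tensor_piP/tensor_rel_scale/tensor_piP; rewrite tensor_reprK. Qed.

Fact tensor_addA : associative tensor_add.
Proof.
move=> x y z.
case: (tensor_pi_surj x) (tensor_pi_surj y) (tensor_pi_surj z) => [s <-] [t <-] [u <-].
by rewrite -!tensor_pi_cat catA.
Qed.
Fact tensor_addC : commutative tensor_add.
Proof. by move=> x y; apply/tensor_piP/tensor_comm. Qed.
Fact tensor_add0 : left_id tensor0 tensor_add.
Proof. by move=> x; case: (tensor_pi_surj x) => s <-; rewrite -tensor_pi_cat. Qed.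

Fact tensor_sclDl x : {morph tensor_scl^~ x : a b / a + b >-> tensor_add a b}.
Proof.
move=> a b; case: (tensor_pi_surj x) => s <-.
rewrite -!tensor_pi_scl -tensor_pi_cat; apply/tensor_piP.
elim: s => [|[p q] s IH] /=; first exact: tensor_refl.
rewrite scalerDl; apply: (tensor_trans (t := [:: (a *: p, q); (b *: p, q)] ++
  (scale_seq a s ++ scale_seq b s))).
  exact: (tensor_cat (tensor_addl _ _ _) IH).
apply: (tensor_cat (s := [:: _]) (s' := [:: _])); first exact: tensor_refl.
rewrite -[X in tensor_rel _ X]/(scale_seq a s ++ ([:: (b *: p, q)] ++ scale_seq b s)).
rewrite -[X in tensor_rel X _]/([:: (b *: p, q)] ++ (scale_seq a s ++ scale_seq b s)).
by rewrite !catA; apply: tensor_cat; [apply: tensor_comm|apply: tensor_refl].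
Qed.
Fact tensor_scl0 x : tensor_scl 0 x = tensor0.
Proof.
case: (tensor_pi_surj x) => s <-; rewrite -tensor_pi_scl; apply/tensor_piP.
elim: s => [|[p q] s IH] /=; first exact: tensor_refl.
by rewrite scale0r; exact: (tensor_cat (tensor_zero q) IH).
Qed.
Fact tensor_scl1 : left_id 1 tensor_scl.
Proof.
move=> x; case: (tensor_pi_surj x) => s <-; rewrite -tensor_pi_scl.
by congr tensor_pi; elim: s => [|[p q] s /= ->] //; rewrite scale1r.
Qed.
Fact tensor_addN : left_inverse tensor0 tensor_opp tensor_add.
Proof.
move=> x; rewrite /tensor_opp -[X in tensor_add _ X]tensor_scl1 -tensor_sclDl.
by rewrite addNr tensor_scl0.
Qed.
HB.instance Definition _ :=
  GRing.isZmodule.Build tensor tensor_addA tensor_addC tensor_add0 tensor_addN.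

Fact tensor_sclA a b x : tensor_scl a (tensor_scl b x) = tensor_scl (a * b) x.
Proof.
case: (tensor_pi_surj x) => s <-; rewrite -!tensor_pi_scl; congr tensor_pi.
by elim: s => [|[p q] s /= ->] //; rewrite scalerA.
Qed.
Fact tensor_sclDr : right_distributive tensor_scl +%R.
Proof.
move=> a x y; case: (tensor_pi_surj x) (tensor_pi_surj y) => [s <-] [t <-].
by rewrite -[_ + _]tensor_pi_cat -!tensor_pi_scl /scale_seq map_cat tensor_pi_cat.
Qed.
HB.instance Definition _ :=
  GRing.Zmodule_isLmodule.Build R tensor tensor_sclA tensor_scl1
    tensor_sclDr tensor_sclDl.

Definition pure (a : A) (b : B) : tensor := tensor_pi [:: (a, b)].

Lemma tensor_piE s : tensor_pi s = \sum_(p <- s) pure p.1 p.2.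
Proof.
elim: s => [|[p q] s IH]; first by rewrite big_nil.
by rewrite big_cons -IH -cat1s tensor_pi_cat.
Qed.

Lemma pure_linear_r a : linear (pure a).
Proof.
move=> r b b'; rewrite /pure -[r *: tensor_pi _]tensor_pi_scl.
rewrite -[RHS]tensor_pi_cat /=; apply/tensor_piP.
apply: tensor_trans (tensor_addr _ _ _) _.
apply: (tensor_cat (s := [:: _]) (s' := [:: _])); last exact: tensor_refl.
exact/tensor_sym/tensor_scale.
Qed.
Lemma pure_linear_l b : linear (pure^~ b).
Proof.
move=> r a a'; rewrite /pure -[r *: tensor_pi _]tensor_pi_scl.
by rewrite -[RHS]tensor_pi_cat /=; apply/tensor_piP/tensor_addl.
Qed.

(* Universal property *)
Section Lift.
Variables (T : lmodType R) (f : {linear A -> hom B T}).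

Definition tensor_lift_fun (x : tensor) : T :=
  \sum_(p <- tensor_repr x) f p.1 p.2.

Fact tensor_lift_pi s : tensor_lift_fun (tensor_pi s) = \sum_(p <- s) f p.1 p.2.
Proof.
have: tensor_rel (tensor_repr (tensor_pi s)) s by apply/tensor_piP/tensor_reprK.
rewrite /tensor_lift_fun; move: (tensor_repr _) => u.
elim=> {u s} [//|s t _ IH|s t u _ IH1 _ IH2|s s' t t' _ IH1 _ IH2
  |s t|b|a a' b|a b b'|k a b].
- by rewrite IH.
- by rewrite IH1.
- by rewrite !big_cat IH1 IH2.
- by rewrite !big_cat /= addrC.
- by rewrite big_seq1 big_nil linear0.
- by rewrite !big_cons !big_nil !addr0 linearD.
- by rewrite !big_cons !big_nil !addr0 linearD.
- by rewrite !big_seq1 !linearZ.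
Qed.

Fact tensor_lift_linear : linear tensor_lift_fun.
Proof.
move=> a x y; case: (tensor_pi_surj x) (tensor_pi_surj y) => [s <-] [t <-].
rewrite -[a *: _]tensor_pi_scl -[_ + _]tensor_pi_cat !tensor_lift_pi big_cat.
congr (_ + _); rewrite big_map scaler_sumr; apply: eq_bigr => p _ /=.
by rewrite linearZ.
Qed.
HB.instance Definition _ :=
  GRing.isLinear.Build R tensor T _ tensor_lift_fun tensor_lift_linear.
Definition tensor_lift : {linear tensor -> T} := tensor_lift_fun.

Lemma tensor_liftE a b : tensor_lift (pure a b) = f a b.
Proof. by rewrite /= tensor_lift_pi big_seq1. Qed.
End Lift.

Lemma tensor_ext (T : lmodType R) (f g : {linear tensor -> T}) :
  (forall a b, f (pure a b) = g (pure a b)) -> forall x, f x = g x.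
Proof.
move=> fg x; case: (tensor_pi_surj x) => s <-.
by rewrite tensor_piE !linear_sum; apply: eq_bigr => p _; apply: fg.
Qed.
End Tensor.

Section TensorMap.
Variables (R : comPzRingType) (A A' B : lmodType R).

HB.instance Definition _ (a : A) :=
  GRing.isLinear.Build R B (tensor A B) _ (pure a) (pure_linear_r a).
Definition pure_hom (a : A) : hom B (tensor A B) :=
  [the {linear B -> tensor A B} of pure a].
Fact pure_hom_linear : linear pure_hom.
Proof. by move=> r a a'; apply: hom_ext => b; apply: pure_linear_l. Qed.
HB.instance Definition _ :=
  GRing.isLinear.Build R A (hom B (tensor A B)) _ pure_hom pure_hom_linear.
End TensorMap.

(* f (x) id_B *)
Definition tensor_map (R : comPzRingType) (A A' B : lmodType R)
    (f : {linear A -> A'}) : {linear tensor A B -> tensor A' B} :=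
  tensor_lift [the {linear A -> hom B (tensor A' B)} of @pure_hom R A' B \o f].
Arguments tensor_map {R A A'} B f.

Lemma tensor_mapE (R : comPzRingType) (A A' B : lmodType R)
  (f : {linear A -> A'}) a b : tensor_map B f (pure a b) = pure (f a) b.
Proof. exact: tensor_liftE. Qed.

Section Classes.
Variable R : comPzRingType.
Implicit Types C E F M P X : lmodType R.

Definition projective P : Prop :=
  forall (A B : lmodType R) (g : {linear A -> B}) (f : {linear P -> B}),
  (forall b, exists a, g a = b) ->
  exists h : {linear P -> A}, forall x, g (h x) = f x.

Definition injective_module E : Prop :=
  forall (A B : lmodType R) (g : {linear A -> B}) (f : {linear A -> E}),
  injective g ->
  exists h : {linear B -> E}, forall x, h (g x) = f x.

Definition flat F : Prop :=
  forall (A B : lmodType R) (g : {linear A -> B}),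
  injective g -> injective (tensor_map F g).

Definition class_PC C X : Prop :=
  exists2 P : lmodType R, projective P & isomorphic X (tensor P C).

Definition class_IC C X : Prop :=
  exists2 E : lmodType R, injective_module E & isomorphic X (hom C E).
End Classes.

(* X_0 <- X_1 <- X_2 <- .. *)
Record chain (R : comPzRingType) := Chain {
  chain_obj :> nat -> lmodType R;
  chain_d : forall n, {linear chain_obj n.+1 -> chain_obj n};
  chain_dd : forall n x, chain_d n (chain_d n.+1 x) = 0 }.
Arguments chain_d {R} X n : rename.

(* X^0 -> X^1 -> X^2 -> .. *)
Record cochain (R : comPzRingType) := Cochain {
  cochain_obj :> nat -> lmodType R;
  cochain_d : forall n, {linear cochain_obj n -> cochain_obj n.+1};
  cochain_dd : forall n x, cochain_d n.+1 (cochain_d n x) = 0 }.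
Arguments cochain_d {R} X n : rename.

Section Complexes.
Variable R : comPzRingType.
Implicit Types (L X : chain R) (J Z : cochain R) (M N Y : lmodType R).

(* Exactness in all degrees, with X_{-1} = 0. *)
Definition chain_exact X : Prop :=
  (forall x : X 0%N, exists y, x = chain_d X 0 y) /\
  (forall n (x : X n.+1), chain_d X n x = 0 -> exists y, x = chain_d X n.+1 y).

(* L^+ : .. -> L_1 -> L_0 -> M -> 0, with M placed in degree 0. *)
Section ChainAug.
Variables (L : chain R) (M : lmodType R) (e : {linear L 0%N -> M}).
Hypothesis ed : forall x, e (chain_d L 0 x) = 0.

Definition chain_aug_obj n : lmodType R := if n is m.+1 then L m else M.
Definition chain_aug_d n :
    {linear chain_aug_obj n.+1 -> chain_aug_obj n} :=
  match n return {linear chain_aug_obj n.+1 -> chain_aug_obj n} with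
  | 0 => e
  | m.+1 => chain_d L m
  end.
Fact chain_aug_dd n x : chain_aug_d n (chain_aug_d n.+1 x) = 0.
Proof. by case: n x => [|n] x; [apply: ed|apply: chain_dd]. Qed.
Definition chain_aug : chain R := Chain chain_aug_dd.
End ChainAug.

(* J^+ : 0 -> N -> J^0 -> J^1 -> .., with N placed in degree 0. *)
Section CochainAug.
Variables (J : cochain R) (N : lmodType R) (e : {linear N -> J 0%N}).
Hypothesis de : forall x, cochain_d J 0 (e x) = 0.

Definition cochain_aug_obj n : lmodType R := if n is m.+1 then J m else N.
Definition cochain_aug_d n :
    {linear cochain_aug_obj n -> cochain_aug_obj n.+1} :=
  match n return {linear cochain_aug_obj n -> cochain_aug_obj n.+1} with
  | 0 => e
  | m.+1 => cochain_d J m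
  end.
Fact cochain_aug_dd n x : cochain_aug_d n.+1 (cochain_aug_d n x) = 0.
Proof. by case: n x => [|n] x; [apply: de|apply: cochain_dd]. Qed.
Definition cochain_aug : cochain R := Cochain cochain_aug_dd.
End CochainAug.

Section HomComplexes.
Variables (X : chain R) (Z : cochain R) (Y : lmodType R).

Fact hom_to_chain_dd n (f : hom Y (X n.+2)) :
  hom_post Y (chain_d X n) (hom_post Y (chain_d X n.+1) f) = 0.
Proof. by apply: hom_ext => x; apply: chain_dd. Qed.
(* Hom(Y, X) *)
Definition hom_to_chain : chain R := Chain hom_to_chain_dd.

Fact hom_to_cochain_dd n (f : hom Y (Z n)) :
  hom_post Y (cochain_d Z n.+1) (hom_post Y (cochain_d Z n) f) = 0.
Proof. by apply: hom_ext => x; apply: cochain_dd. Qed.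
(* Hom(Y, Z) *)
Definition hom_to_cochain : cochain R := Cochain hom_to_cochain_dd.

Fact hom_from_chain_dd n (f : hom (X n) Y) :
  hom_pre Y (chain_d X n.+1) (hom_pre Y (chain_d X n) f) = 0.
Proof. by apply: hom_ext => x /=; rewrite chain_dd linear0. Qed.
(* Hom(X, Y) *)
Definition hom_from_chain : cochain R := Cochain hom_from_chain_dd.

Fact hom_from_cochain_dd n (f : hom (Z n.+2) Y) :
  hom_pre Y (cochain_d Z n) (hom_pre Y (cochain_d Z n.+1) f) = 0.
Proof. by apply: hom_ext => x /=; rewrite cochain_dd linear0. Qed.
(* Hom(Z, Y) *)
Definition hom_from_cochain : chain R := Chain hom_from_cochain_dd.
End HomComplexes.

Section Cohomology.
Variables (Z : cochain R) (n : nat).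

Definition cocycle_pred : {pred Z n} := [pred x | cochain_d Z n x == 0].
Fact cocycle_pred_closed : submod_closed cocycle_pred.
Proof.
split=> [|a x y]; rewrite !inE ?linear0 // => /eqP dx /eqP dy.
by rewrite linearP dx dy scaler0 addr0.
Qed.
HB.instance Definition _ :=
  GRing.isSubmodClosed.Build R (Z n) cocycle_pred cocycle_pred_closed.

Record cocycle : Type := Cocycle
  { cocycle_val :> Z n; cocycleP : cocycle_val \in cocycle_pred }.
HB.instance Definition _ := [isSub for cocycle_val].
HB.instance Definition _ := [Choice of cocycle by <:].
HB.instance Definition _ := [SubChoice_isSubLmodule of cocycle by <:].
End Cohomology.

Definition is_coboundary Z n : Z n -> Prop :=
  match n return Z n -> Prop with
  | 0 => fun x => x = 0
  | m.+1 => fun x => exists y, x = cochain_d Z m y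
  end.

Definition coboundary Z n : {pred cocycle Z n} :=
  [pred x : cocycle Z n | `[< is_coboundary (val x) >]].

Fact coboundary_closed Z n : submod_closed (@coboundary Z n).
Proof.
split=> [|a x y].
  by apply/asboolP; case: n => [|n] //=; exists 0; rewrite linear0.
move=> /asboolP bx /asboolP bby; apply/asboolP.
case: n x y bx bby => [|n] x y /=; first by move=> -> ->; rewrite scaler0 addr0.
by move=> [u ->] [v ->]; exists (a *: u + v); rewrite linearP.
Qed.

(* ker(Z^n -> Z^{n+1}) / im(Z^{n-1} -> Z^n), with Z^{-1} = 0. *)
Definition cohomology Z n : lmodType R := quot_mod (@coboundary_closed Z n).
End Complexes.

Record proj_resolution (R : comPzRingType) (M : lmodType R) := ProjResolution {
  pr_complex :> chain R;
  pr_aug : {linear pr_complex 0%N -> M};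
  pr_augd : forall x, pr_aug (chain_d pr_complex 0 x) = 0;
  pr_proj : forall n, projective (pr_complex n);
  pr_exact : chain_exact (chain_aug pr_augd) }.

(* Ext^i_R(M, N), computed with the projective resolution P of M. *)
Definition Ext (R : comPzRingType) (M : lmodType R) (P : proj_resolution M)
    (N : lmodType R) (i : nat) : lmodType R :=
  cohomology (hom_from_chain P N) i.

Section Homothety.
Variables (R : comPzRingType) (C : lmodType R).

Definition homothety_fun (r : R^o) : hom C C :=
  [the {linear C -> C} of (r : R) \*: idfun].
Fact homothety_linear : linear homothety_fun.
Proof.
by move=> a r s; apply: hom_ext => x; rewrite homDE homZE /= scalerDl -scalerA.
Qed.
HB.instance Definition _ :=
  GRing.isLinear.Build R R^o (hom C C) _ homothety_fun homothety_linear.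
Definition homothety : {linear R^o -> hom C C} := homothety_fun.
End Homothety.

Record semidualizing (R : comPzRingType) (C : lmodType R) : Prop := Semidualizing {
  semidual_fg : fin_gen C;
  semidual_homothety : bijective (homothety C);
  semidual_ext : forall (P : proj_resolution C) (i : nat), (1 <= i)%N ->
    forall x : Ext P C i, x = 0 }.

Record proper_PC_resolution (R : comPzRingType) (C M : lmodType R) :=
  ProperPCResolution {
  pcr_complex :> chain R;
  pcr_aug : {linear pcr_complex 0%N -> M};
  pcr_augd : forall x, pcr_aug (chain_d pcr_complex 0 x) = 0;
  pcr_PC : forall n, class_PC C (pcr_complex n);
  pcr_proper : forall Y : lmodType R, class_PC C Y ->
    chain_exact (hom_to_chain (chain_aug pcr_augd) Y) }.

Record proper_IC_coresolution (R : comPzRingType) (C N : lmodType R) :=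
  ProperICCoresolution {
  icr_complex :> cochain R;
  icr_aug : {linear N -> icr_complex 0%N};
  icr_augd : forall x, cochain_d icr_complex 0 (icr_aug x) = 0;
  icr_IC : forall n, class_IC C (icr_complex n);
  icr_proper : forall Y : lmodType R, class_IC C Y ->
    chain_exact (hom_from_cochain (cochain_aug icr_augd) Y) }.

(* The two relative Ext modules do not depend, up to isomorphism, on the
   (co)resolution; it is an argument here. *)
Definition Ext_PCM (R : comPzRingType) (C M : lmodType R)
    (L : proper_PC_resolution C M) (N : lmodType R) (i : nat) : lmodType R :=
  cohomology (hom_from_chain L N) i.

Definition Ext_MIC (R : comPzRingType) (C M N : lmodType R)
    (J : proper_IC_coresolution C N) (i : nat) : lmodType R :=
  cohomology (hom_to_cochain J M) i.
Arguments Ext_MIC {R C} M {N} J i.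

(* Main.v *)
From HB Require Import structures.
From mathcomp Require Import all_boot all_algebra.
From mathcomp Require Import boolp classical_sets.
Require Import Defs.

(** Both isomorphisms come from one natural map,
    Hom(M, X) (x) F -> Hom(M, X (x) F), sending phi (x) y to m |-> phi m (x) y.
    It is bijective when M is finitely generated over the noetherian ring R
    and F is flat ([tensor_eval_bij]), and flatness also lets F pass through
    cohomology ([tensor_cohomology]).  What remains is to choose the
    resolutions so that the natural map applies degreewise, and to know that
    the choice does not matter.

    The independence of the choice is the classical comparison theorem:
    maps out of a resolution are built degree by degree, any two of them are
    homotopic, and so two resolutions of the same object by objects of a class
    W, both exact under Hom(V, -) for all V in W, represent the same
    cohomology.  It is proved once, in an abstract R-linear category
    ([cohomology_comparison]), and is used for proper P_C-resolutions in the
    category of modules and for proper I_C-coresolutions in its opposite.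

    For P_C, the module M has a proper resolution G whose terms are of the
    form R^k (x) C ([fg_resolution]): the kernel of Hom(C, G_n) ->
    Hom(C, G_(n-1)) is finitely generated because R is noetherian, and a
    finite family of generators defines G_(n+1) -> G_n.  All the terms of G
    are finitely generated, so Hom(G, N) (x) F is isomorphic to
    Hom(G, N (x) F).

    For I_C, let J be a proper coresolution of N.  Then J (x) F is a proper
    coresolution of N (x) F.  Its terms are in I_C because
    Hom(C, E) (x) F = Hom(C, E (x) F), where E (x) F is injective by Baer's
    criterion ([injective_tensor_flat]).  It is proper because
    Hom(J (x) F, Y) = Hom(J, Hom(F, Y)), where Hom(F, Hom(C, E)) =
    Hom(C, Hom(F, E)) is again in I_C: Hom(F, E) is injective since F is flat
    ([tensor_proper_IC_exact]).  Finally Hom(M, J) (x) F is isomorphic to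
    Hom(M, J (x) F) since M is finitely generated. *)

Set Implicit Arguments.
Unset Strict Implicit.
Unset Printing Implicit Defensive.

Import GRing.Theory.
Local Open Scope ring_scope.

(** * Linear maps and quotients *)

Definition mk_linear (R : pzRingType) (U V : lmodType R) (f : U -> V)
    (lf : linear f) : {linear U -> V} :=
  HB.pack f (GRing.isLinear.Build R U V *:%R f lf).

(** The values of [h] are forced, and they do not depend on the preimage that
    is chosen since [g] vanishes on the kernel of [p].  This is how maps out
    of quotients are obtained below. *)
Lemma factor_surj (R : pzRingType) (A Q W : lmodType R) (p : {linear A -> Q})
    (g : {linear A -> W}) :
  (forall q, exists a, p a = q) -> (forall a, p a = 0 -> g a = 0) ->
  exists h : {linear Q -> W}, forall a, h (p a) = g a.
Proof.
move=> surj ker; pose r q := sval (cid (surj q)).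
have pr q : p (r q) = q by rewrite /r; case: cid.
have wd a b : p a = p b -> g a = g b.
  move=> ab; apply/eqP; rewrite -subr_eq0 -linearB; apply/eqP/ker.
  by rewrite linearB ab subrr.
have lin : linear (g \o r).
  by move=> a x y /=; rewrite -linearP; apply: wd; rewrite linearP !pr.
by exists (mk_linear lin) => a /=; apply: wd; rewrite pr.
Qed.

(** Both modules are the quotient of [K] by the common kernel.  Comparing them
    through a third module in this way avoids writing down an inverse. *)
Lemma isomorphic_same_kernel (R : pzRingType) (K U V : lmodType R)
    (p : {linear K -> U}) (q : {linear K -> V}) :
  (forall u, exists a, p a = u) -> (forall v, exists a, q a = v) ->
  (forall a, p a = 0 <-> q a = 0) -> isomorphic U V.
Proof.
move=> sp sq ker.
have [f fE] := factor_surj sp (fun a => (ker a).1).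
have [g gE] := factor_surj sq (fun a => (ker a).2).
exists f; exists g => x; first by have [a <-] := sp x; rewrite fE gE.
by have [a <-] := sq x; rewrite gE fE.
Qed.

Lemma linear_inverse (R : pzRingType) (U V : lmodType R) (f : {linear U -> V}) :
  bijective f -> exists g : {linear V -> U}, cancel f g /\ cancel g f.
Proof.
move=> [g fK gK].
have lg : linear g by move=> a x y; rewrite -{1}[x]gK -{1}[y]gK -linearP fK.
by exists (mk_linear lg).
Qed.

Lemma isomorphic_refl (R : pzRingType) (U : lmodType R) : isomorphic U U.
Proof. by exists idfun; exists idfun. Qed.

Lemma isomorphic_sym (R : pzRingType) (U V : lmodType R) :
  isomorphic U V -> isomorphic V U.
Proof.
by move=> [f /linear_inverse[g [fK gK]]]; exists g; exists f.
Qed.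

Lemma isomorphic_trans (R : pzRingType) (U V W : lmodType R) :
  isomorphic U V -> isomorphic V W -> isomorphic U W.
Proof. by move=> [f bf] [g bg]; exists (g \o f); apply: bij_comp. Qed.

Section Kernel.
Variables (R : pzRingType) (A B : lmodType R) (g : {linear A -> B}).

Lemma kernel_closed : submod_closed [pred x | g x == 0].
Proof.
split=> [|a x y]; rewrite !inE ?linear0 // => /eqP gx /eqP gy.
by rewrite linearP gx gy scaler0 addr0.
Qed.

(** The coimage A / ker g plays the part of the image of [g], which makes it
    possible to apply the defining properties of flat, projective and
    injective modules to maps that are neither injective nor surjective. *)
Lemma coimage : exists (Q : lmodType R) (p : {linear A -> Q})
    (m : {linear Q -> B}),
  [/\ forall q, exists a, p a = q, injective m & forall a, m (p a) = g a].
Proof.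
exists (quot_mod kernel_closed), (quot_proj kernel_closed).
have ker a : quot_proj kernel_closed a = 0 <-> g a = 0.
  rewrite -(linear0 (quot_proj kernel_closed)) quot_projP subr0.
  by rewrite inE; split => [/eqP|/eqP].
have surj q : exists a, quot_proj kernel_closed a = q by apply: quot_proj_surj.
have [m mE] := factor_surj surj (fun a => (ker a).1).
exists m; split=> //; apply: raddf_inj => q; have [a <-] := surj q => mq.
by apply/ker; rewrite -mE.
Qed.
End Kernel.

Lemma linear_bij (R : pzRingType) (U V : lmodType R) (f : {linear U -> V}) :
  (forall x, f x = 0 -> x = 0) -> (forall y, exists x, f x = y) -> bijective f.
Proof.
move=> ker surj; pose g y := sval (cid (surj y)).
have fg y : f (g y) = y by rewrite /g; case: cid.
exists g => // x; apply/eqP; rewrite -subr_eq0; apply/eqP/ker.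
by rewrite linearB fg subrr.
Qed.

(** * Lifting problems and exactness of tensor products *)

Section Lifting.
Variable R : comPzRingType.

(** The target of the surjection in the definition of projectivity is replaced
    by the coimage of [g], through which [f] factors. *)
Lemma projective_lift (P A B : lmodType R) (g : {linear A -> B})
    (f : {linear P -> B}) :
  projective P -> (forall p, exists a, f p = g a) ->
  exists h : {linear P -> A}, forall p, g (h p) = f p.
Proof.
move=> projP im; have [Q [q [m [sq m_inj mq]]]] := coimage g.
have imq p : exists z, m z = f p by have [a ->] := im p; exists (q a).
have [r rP] := choice imq.
have lin : linear r by move=> c x y; apply: m_inj; rewrite linearP !rP linearP.
have [h hE] := projP _ _ q (mk_linear lin) sq.
by exists h => p; rewrite -mq hE; apply: rP.
Qed.

(** [f] factors through the coimage of [g], which embeds into [B]. *)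
Lemma injective_extend (E A B : lmodType R) (g : {linear A -> B})
    (f : {linear A -> E}) :
  injective_module E -> (forall a, g a = 0 -> f a = 0) ->
  exists h : {linear B -> E}, forall a, h (g a) = f a.
Proof.
move=> injE ker; have [Q [p [m [sp im mp]]]] := coimage g.
have [|f' f'E] := factor_surj (g := f) sp.
  by move=> a pa; apply: ker; rewrite -mp pa linear0.
have [h hE] := injE _ _ m f' im.
by exists h => a; rewrite -mp hE.
Qed.

Lemma injective_hom_exact (E A B D : lmodType R) (f : {linear A -> B})
    (g : {linear B -> D}) :
  injective_module E -> (forall b, g b = 0 -> exists a, b = f a) ->
  forall phi : hom B E, hom_pre E f phi = 0 ->
  exists psi, phi = hom_pre E g psi.
Proof.
move=> injE ker phi phi0; have [|h hE] := injective_extend (g := g) (f := phi) injE.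
  by move=> b /ker[a ->]; apply: (congr1 (fun h : hom _ _ => h a) phi0).
by exists h; apply: hom_ext => b; rewrite -hE.
Qed.

End Lifting.

Section TensorExact.
Variables (R : comPzRingType) (F : lmodType R).

Lemma tensor_map_comp (A B D : lmodType R) (f : {linear A -> B})
    (g : {linear B -> D}) (h : {linear A -> D}) :
  (forall a, g (f a) = h a) ->
  forall t, tensor_map F g (tensor_map F f t) = tensor_map F h t.
Proof.
move=> gf t; rewrite -[LHS]/((tensor_map F g \o tensor_map F f) t).
apply: tensor_ext => a y.
by rewrite -[LHS]/(tensor_map F g (tensor_map F f (pure a y))) !tensor_mapE gf.
Qed.

Lemma tensor_map0 (A B : lmodType R) (f : {linear A -> B}) :
  (forall a, f a = 0) -> forall t, tensor_map F f t = 0.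
Proof.
move=> f0 t; rewrite -[RHS]/((\0 : {linear _ -> _}) t).
apply: tensor_ext => a y; rewrite tensor_mapE f0.
exact: (linear0 (mk_linear (@pure_linear_l R B F y))).
Qed.

Lemma image_closed (A B : lmodType R) (f : {linear A -> B}) :
  submod_closed [pred b | `[< exists a, b = f a >]].
Proof.
split=> [|r x y]; first by apply/asboolP; exists 0; rewrite linear0.
move=> /asboolP[a ->] /asboolP[b ->]; apply/asboolP; exists (r *: a + b).
by rewrite linearP.
Qed.

Lemma tensor_map_surj (A B : lmodType R) (f : {linear A -> B}) :
  (forall b, exists a, f a = b) -> forall t, exists u, tensor_map F f u = t.
Proof.
move=> surj t; have [s <-] := tensor_pi_surj t; rewrite tensor_piE.
elim: s => [|[b y] s [u uE]]; first by exists 0; rewrite big_nil linear0.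
have [a aE] := surj b; exists (pure a y + u).
by rewrite big_cons linearD uE tensor_mapE aE.
Qed.

(** The cokernel of [tensor_map F f] receives a map from [tensor Q F]: send
    q (x) y to the class of b (x) y for any b over q.  Composed with
    [tensor_map F p] it is the quotient map, hence the kernel of
    [tensor_map F p] consists of elements of class zero. *)
Lemma tensor_right_exact (A B Q : lmodType R) (f : {linear A -> B})
    (p : {linear B -> Q}) :
  (forall q, exists b, p b = q) -> (forall b, p b = 0 -> exists a, b = f a) ->
  forall t, tensor_map F p t = 0 -> exists u, t = tensor_map F f u.
Proof.
move=> surj ker t pt0.
pose c := quot_proj (image_closed (tensor_map F f)).
(* b goes to the class of y |-> b (x) y. *)
pose g := [the {linear B -> hom F _} of hom_post F c \o @pure_hom R B F].
have gE b y : g b y = c (pure b y) by [].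
have g0 b : p b = 0 -> g b = 0.
  move=> /ker[a ->]; apply: hom_ext => y; rewrite gE -tensor_mapE.
  rewrite -[RHS](linear0 c); apply/quot_projP; rewrite subr0.
  by apply/asboolP; exists (pure a y).
have [h hE] := factor_surj surj g0.
have : tensor_lift h (tensor_map F p t) = c t.
  rewrite -[LHS]/((tensor_lift h \o tensor_map F p) t).
  apply: tensor_ext => b y.
  rewrite -[LHS]/(tensor_lift h (tensor_map F p (pure b y))).
  by rewrite tensor_mapE tensor_liftE hE.
rewrite pt0 linear0 -(linear0 c) => /esym/quot_projP.
by rewrite subr0 => /asboolP.
Qed.

(** [g] is a surjection onto its coimage followed by an injection; tensoring
    with [F] preserves the injection, and the surjection is handled by right
    exactness. *)
Lemma flat_exact (A B D : lmodType R) (f : {linear A -> B})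
    (g : {linear B -> D}) :
  flat F -> (forall b, g b = 0 -> exists a, b = f a) ->
  forall t, tensor_map F g t = 0 -> exists u, t = tensor_map F f u.
Proof.
move=> flatF ker t; have [Q [p [m [sp im mp]]]] := coimage g.
rewrite -(tensor_map_comp mp) -(linear0 (tensor_map F m)) => /(flatF _ _ _ im).
apply: tensor_right_exact => // b pb; apply: ker.
by rewrite -mp pb linear0.
Qed.
End TensorExact.

(** * Tensor products with modules of homomorphisms *)

Section TensorEval.
Variables (R : comPzRingType).
Implicit Types A B M X F T : lmodType R.

Definition pure_right X F (y : F) : hom X (tensor X F) :=
  mk_linear (@pure_linear_l R X F y).

Lemma pure_right_linear X F : linear (@pure_right X F).
Proof. by move=> r y z; apply: hom_ext => x; apply: pure_linear_r. Qed.

Definition tensor_eval_pure M X F (phi : hom M X) :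
    hom F (hom M (tensor X F)) :=
  [the {linear F -> hom M (tensor X F)} of
    hom_pre (tensor X F) phi \o mk_linear (@pure_right_linear X F)].

Lemma tensor_eval_pure_linear M X F : linear (@tensor_eval_pure M X F).
Proof.
move=> r phi psi; apply: hom_ext => y; apply: hom_ext => m.
exact: (pure_linear_l y r (phi m) (psi m)).
Qed.

(** The natural map Hom(M, X) (x) F -> Hom(M, X (x) F). *)
Definition tensor_eval M X F :
    {linear tensor (hom M X) F -> hom M (tensor X F)} :=
  tensor_lift (mk_linear (@tensor_eval_pure_linear M X F)).

Lemma tensor_evalE M X F phi y m :
  tensor_eval M X F (pure phi y) m = pure (phi m) y.
Proof. by rewrite /tensor_eval tensor_liftE. Qed.

Lemma tensor_eval_pre A M X F (g : {linear A -> M}) t :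
  tensor_eval A X F (tensor_map F (hom_pre X g) t) =
  hom_pre (tensor X F) g (tensor_eval M X F t).
Proof.
rewrite -[LHS]/((tensor_eval A X F \o tensor_map F (hom_pre X g)) t).
rewrite -[RHS]/((hom_pre (tensor X F) g \o tensor_eval M X F) t).
apply: tensor_ext => phi y; apply: hom_ext => a.
rewrite -[LHS]/(tensor_eval A X F (tensor_map F (hom_pre X g) (pure phi y)) a).
rewrite -[RHS]/(tensor_eval M X F (pure phi y) (g a)).
by rewrite tensor_mapE !tensor_evalE.
Qed.

Lemma tensor_eval_post M X T F (g : {linear X -> T}) t :
  tensor_eval M T F (tensor_map F (hom_post M g) t) =
  hom_post M (tensor_map F g) (tensor_eval M X F t).
Proof.
rewrite -[LHS]/((tensor_eval M T F \o tensor_map F (hom_post M g)) t).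
rewrite -[RHS]/((hom_post M (tensor_map F g) \o tensor_eval M X F) t).
apply: tensor_ext => phi y; apply: hom_ext => a.
rewrite -[LHS]/(tensor_eval M T F (tensor_map F (hom_post M g) (pure phi y)) a).
rewrite -[RHS]/(tensor_map F g (tensor_eval M X F (pure phi y) a)).
by rewrite tensor_mapE !tensor_evalE tensor_mapE.
Qed.
End TensorEval.

(** * Free modules of finite rank *)

Local Notation free R k := ({ffun 'I_k -> R^o} : lmodType R).

Section Free.
Variable R : comPzRingType.

Definition free_unit k (i : 'I_k) : free R k := [ffun j => (i == j)%:R].

Lemma free_sum k (v : free R k) : v = \sum_i v i *: free_unit i.
Proof.
apply/ffunP => j; rewrite sum_ffunE (bigD1 j) //= big1 ?addr0.
  by rewrite !ffunE eqxx [RHS]mulr1.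
by move=> i /negbTE ij; rewrite !ffunE ij [LHS]mulr0.
Qed.

Section FreeMap.
Variables (k : nat) (V : lmodType R) (x : 'I_k -> V).

Lemma free_map_linear : linear (fun v : free R k => \sum_i v i *: x i).
Proof.
move=> r v w; rewrite scaler_sumr -big_split; apply: eq_bigr => i _.
by rewrite !ffunE scalerDl scalerA.
Qed.
Definition free_map : {linear free R k -> V} := mk_linear free_map_linear.

End FreeMap.

Lemma free_linearE k (V : lmodType R) (f : {linear free R k -> V}) v :
  f v = \sum_i v i *: f (free_unit i).
Proof.
by rewrite {1}[v]free_sum linear_sum; apply: eq_bigr => i _; rewrite linearZ.
Qed.

Section CoordHom.
Variables (k : nat) (X : lmodType R) (i : 'I_k).

Lemma coord_hom_fun_linear (x : X) : linear (fun v : free R k => v i *: x).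
Proof. by move=> r v w; rewrite !ffunE scalerDl scalerA. Qed.

Lemma coord_hom_linear :
  linear (fun x : X => mk_linear (coord_hom_fun_linear x) : hom (free R k) X).
Proof.
move=> r x y; apply: hom_ext => v; rewrite homDE homZE.
by rewrite /= scalerDr !scalerA mulrC.
Qed.
(** [x] goes to [v |-> v i *: x]; these maps present Hom(R^k, X) as the direct
    sum of [k] copies of [X]. *)
Definition coord_hom : {linear X -> hom (free R k) X} := mk_linear coord_hom_linear.

Lemma coord_homE x v : coord_hom x v = v i *: x. Proof. by []. Qed.
End CoordHom.

Lemma hom_sumE (A B : lmodType R) (I : Type) (r : seq I) (f : I -> hom A B) a :
  (\sum_(i <- r) f i) a = \sum_(i <- r) f i a.
Proof.
elim: r => [|i r IH]; first by rewrite !big_nil.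
by rewrite !big_cons homDE IH.
Qed.

Lemma tensor_eval_coord k (X F : lmodType R) (i : 'I_k) t v :
  tensor_eval (free R k) X F (tensor_map F (coord_hom X i) t) v = v i *: t.
Proof.
have lin : linear (fun t =>
    tensor_eval (free R k) X F (tensor_map F (coord_hom X i) t) v).
  by move=> r a b; rewrite !linearP.
rewrite -[LHS]/(mk_linear lin t) -[RHS]/((v i \*: idfun) t).
apply: tensor_ext => x y.
rewrite -[LHS]/(tensor_eval (free R k) X F (tensor_map F (coord_hom X i) (pure x y)) v).
rewrite tensor_mapE tensor_evalE coord_homE.
by rewrite -[LHS]/((pure_right X y : {linear _ -> _}) (v i *: x)) linearZ.
Qed.

(** The inverse decomposes a map [g] on R^k according to its values
    [g (free_unit i)], each of which [coord_hom X i] carries back to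
    Hom(R^k, X) (x) F. *)
Lemma tensor_eval_free k (X F : lmodType R) :
  bijective (tensor_eval (free R k) X F).
Proof.
pose psi (g : hom (free R k) (tensor X F)) :=
  \sum_i tensor_map F (coord_hom X i) (g (free_unit i)).
have lin : linear psi.
  move=> r g h; rewrite /psi scaler_sumr -big_split; apply: eq_bigr => i _.
  by rewrite homDE homZE linearP.
exists psi => [t|g].
  rewrite -[LHS]/((mk_linear lin \o tensor_eval (free R k) X F) t).
  rewrite -[RHS]/(idfun t); apply: tensor_ext => phi y.
  rewrite -[LHS]/(psi (tensor_eval (free R k) X F (pure phi y))) /psi.
  under eq_bigr do rewrite tensor_evalE tensor_mapE.
  rewrite -[LHS](linear_sum (mk_linear (@pure_linear_l R _ F y))) /=.
  congr (pure _ y); apply: hom_ext => v.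
  by rewrite hom_sumE [RHS]free_linearE.
apply: hom_ext => v; rewrite /psi linear_sum hom_sumE [RHS]free_linearE.
by apply: eq_bigr => i _; rewrite tensor_eval_coord.
Qed.

End Free.

Lemma projective_free (R : comPzRingType) k : projective (free R k).
Proof.
move=> A B g f surj; have [a aP] := choice (fun i => surj (f (free_unit R i))).
exists (free_map a) => v; rewrite linear_sum [RHS]free_linearE.
by apply: eq_bigr => i _; rewrite linearZ aP.
Qed.

(** * Finitely generated modules over a noetherian ring *)

Section Noetherian.
Variable R : comPzRingType.

(** A recursive form of [lin_comb], better suited to induction on the list of
    generators. *)
Fixpoint span (V : lmodType R) (s : seq V) (x : V) : Prop :=
  if s is v :: s' then exists r w, span s' w /\ x = r *: v + w else x = 0.

Lemma lin_combE (V : lmodType R) (s : seq V) x : lin_comb s x <-> span s x.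
Proof.
elim: s x => [|v s IH] x /=.
  split=> [[a ->]|->]; first by rewrite big_ord0.
  by exists (fun _ => 0); rewrite big_ord0.
split=> [[a ->]|[r [w [/IH[a ->] ->]]]].
  rewrite big_ord_recl; exists (a ord0), (\sum_(i < size s) a (lift ord0 i) *: s`_i).
  by split=> //; apply/IH; exists (fun i => a (lift ord0 i)).
exists (fun i => if unlift ord0 i is Some j then a j else r).
rewrite big_ord_recl unlift_none /=; congr (_ + _).
by apply: eq_bigr => i _; rewrite liftK.
Qed.

Lemma span_linear (V : lmodType R) (s : seq V) r x y :
  span s x -> span s y -> span s (r *: x + y).
Proof.
elim: s x y => [|v s IH] x y /=; first by move=> -> ->; rewrite scaler0 addr0.
move=> [a [w [sw ->]]] [b [z [sz ->]]]; exists (r * a + b), (r *: w + z).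
split; first exact: IH.
by rewrite scalerDr scalerDl scalerA addrACA.
Qed.

Lemma span0 (V : lmodType R) (s : seq V) : span s 0.
Proof. by elim: s => //= v s IH; exists 0, 0; rewrite scale0r addr0. Qed.

Lemma mem_span (V : lmodType R) (s : seq V) x : x \in s -> span s x.
Proof.
elim: s => //= v s IH; rewrite inE => /orP[/eqP->|/IH sx].
  by exists 1, 0; split; [apply: span0|rewrite scale1r addr0].
by exists 0, x; rewrite scale0r add0r.
Qed.

Lemma span_sub (V : lmodType R) (S : V -> Prop) (s : seq V) x :
  S 0 -> (forall r y z, S y -> S z -> S (r *: y + z)) ->
  (forall v, v \in s -> S v) -> span s x -> S x.
Proof.
move=> S0 Slin; elim: s x => [|v s IH] x sS /=; first by move=> ->.
move=> [r [w [sw ->]]]; apply: Slin; first by apply: sS; rewrite mem_head.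
by apply: IH => // u us; apply: sS; rewrite inE us orbT.
Qed.

(** Hilbert's argument, by induction on the list of generators v :: s of the
    ambient module.  The coefficients of v in the elements of S form an ideal,
    which is finitely generated; lifts to S of generators of this ideal,
    together with generators of the part of S that lies in the span of s,
    generate S. *)
Lemma noetherian_submodule (V : lmodType R) (S : V -> Prop) (s : seq V) :
  noetherian R -> S 0 -> (forall r y z, S y -> S z -> S (r *: y + z)) ->
  (forall x, S x -> span s x) ->
  exists t : seq V, forall x, S x <-> span t x.
Proof.
move=> noethR; elim: s S => [|v s IH] S S0 Slin sub.
  by exists [::] => x; split=> [/sub|/= ->].
pose I : {pred R^o} := [pred r | `[< exists2 w, span s w & S (r *: v + w) >]].
have Icl : submod_closed I.
  split=> [|r a b].
    by apply/asboolP; exists 0; [apply: span0|rewrite scale0r addr0].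
  move=> /asboolP[w sw Sw] /asboolP[z sz Sz]; apply/asboolP.
  exists (r *: w + z); first exact: span_linear.
  have := Slin r _ _ Sw Sz; rewrite scalerDr scalerA addrACA -scalerDl.
  by [].
have [a aP] := noethR I Icl.
have [|r x y [Sx sx] [Sy sy]|x []//|t tP] := IH (fun x => S x /\ span s x).
- by split; [|apply: span0].
- by split; [apply: Slin|apply: span_linear].
(* An element of S with leading coefficient r, modulo the span of s. *)
have lift (r : R^o) : exists x, r \in I -> S x /\ span s (x - r *: v).
  have [/asboolP[w sw Sw]|] := boolP (r \in I); last by exists 0.
  by exists (r *: v + w) => _; rewrite addrAC subrr add0r.
have [l lP] := choice lift.
have aI r : r \in a -> r \in I by move=> ra; apply/aP/lin_combE/mem_span.
have tS x : span t x -> S x by move=> /tP[].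
exists ([seq l r | r <- a] ++ t) => x; split; last first.
  apply: span_sub => // y; rewrite mem_cat => /orP[/mapP[r ra ->]|yt].
    by have [] := lP r (aI r ra).
  by apply/tS/mem_span.
move=> Sx.
have span_cat y z : span [seq l r | r <- a] y -> span t z ->
    span ([seq l r | r <- a] ++ t) (y + z).
  move=> sy sz; rewrite -[y]scale1r; apply: span_linear.
    apply: span_sub sy => [|r u w su sw|u ua]; first exact: span0.
      exact: span_linear.
    by apply: mem_span; rewrite mem_cat ua.
  apply: span_sub sz => [|r u w su sw|u ut]; first exact: span0.
    exact: span_linear.
  by apply: mem_span; rewrite mem_cat ut orbT.
have [r [w [sw xE]]] := sub x Sx.
have /aP/lin_combE ra : r \in I by apply/asboolP; exists w => //; rewrite -xE.
have [y sy [Sy yr]] : exists2 y, span [seq l r | r <- a] y &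
    S y /\ span s (y - r *: v).
  apply: (span_sub (S := fun r : R^o => exists2 y,
    span [seq l r | r <- a] y & S y /\ span s (y - r *: v))) ra.
  - by exists 0; [apply: span0|split=> //; rewrite scale0r subr0; apply: span0].
  - move=> c b d [y sy [Sy yb]] [z sz [Sz zd]]; exists (c *: y + z).
      exact: span_linear.
    split; first exact: Slin.
    suff -> : c *: y + z - (c *: b + d) *: v = c *: (y - b *: v) + (z - d *: v).
      exact: span_linear.
    by rewrite scalerBr scalerDl scalerA opprD addrACA.
  move=> b ba; exists (l b); first by apply: mem_span; apply: map_f.
  exact: lP (aI b ba).
rewrite -(subrK y x) addrC; apply: span_cat => //; apply/tP.
split; first by have := Slin (-1) y x Sy Sx; rewrite scaleN1r addrC.
have -> : x - y = (-1) *: (y - r *: v) + w.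
  by rewrite scaleN1r opprB xE addrAC.
exact: span_linear.
Qed.

(** The source of all finite presentations and syzygies used below: taking for
    [d] the zero map gives a surjection onto [V]. *)
Lemma free_cover (V W : lmodType R) (d : {linear V -> W}) :
  noetherian R -> fin_gen V ->
  exists k (u : {linear free R k -> V}), forall x, d x = 0 <-> exists r, x = u r.
Proof.
move=> noethR [s sP].
have [|r y z dy dz|x _|t tP] :=
  noetherian_submodule (S := fun x => d x = 0) (s := s) noethR.
- exact: linear0.
- by rewrite linearP dy dz scaler0 addr0.
- exact/lin_combE.
exists (size t), (free_map (fun i => t`_i)) => x; rewrite tP -lin_combE.
split=> [[a ->]|[r ->]]; last by exists r.
by exists (finfun a); apply: eq_bigr => i _; rewrite ffunE.
Qed.

Lemma fin_gen_sum k (U V : lmodType R) (f : 'I_k -> {linear U -> V}) :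
  fin_gen U -> (forall v, exists u, v = \sum_i f i (u i)) -> fin_gen V.
Proof.
move=> [s sP] sumV; exists [seq f i x | i <- enum 'I_k, x <- s] => v.
have [u ->] := sumV v; apply/lin_combE.
elim/big_ind: _ => [|x y sx sy|i _]; first exact: span0.
  by rewrite -[x]scale1r; apply: span_linear.
have /lin_combE := sP (u i).
apply: (span_sub (S := fun x => span _ (f i x))) => [|r x y sx sy|x xs].
- by rewrite linear0; apply: span0.
- by rewrite linearP; apply: span_linear.
by apply/mem_span/allpairsP; exists (i, x); rewrite mem_enum.
Qed.

Lemma fin_gen_free k : fin_gen (free R k).
Proof.
exists [seq free_unit R i | i <- enum 'I_k] => v; apply/lin_combE.
rewrite [v]free_sum; elim/big_ind: _ => [|x y sx sy|i _].
- exact: span0.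
- by rewrite -[x]scale1r; apply: span_linear.
rewrite -[_ *: _]addr0; apply: span_linear; last exact: span0.
by apply/mem_span/map_f; rewrite mem_enum.
Qed.

Lemma fin_gen_tensor_free k (C : lmodType R) :
  fin_gen C -> fin_gen (tensor (free R k) C).
Proof.
move=> fgC; apply: (fin_gen_sum (f := fun i => pure_hom C (free_unit R i)) fgC).
move=> v; have [s <-] := tensor_pi_surj v; rewrite tensor_piE.
elim: s => [|[a c] s [u uE]].
  exists (fun=> 0); rewrite big_nil big1 // => i _; exact: linear0.
exists (fun i => a i *: c + u i); rewrite big_cons uE.
under [RHS]eq_bigr do rewrite linearD.
rewrite big_split; congr (_ + _); rewrite /= {1}[a]free_sum.
rewrite -[LHS]/(mk_linear (@pure_linear_l R _ C c) _) linear_sum.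
by apply: eq_bigr => i _; rewrite linearZ linearZ.
Qed.

Lemma fin_gen_inj (U V : lmodType R) (g : {linear U -> V}) :
  noetherian R -> injective g -> fin_gen V -> fin_gen U.
Proof.
move=> noethR ginj [s sP].
have [|r x y [u ->] [v ->]|x _|t tP] :=
  noetherian_submodule (S := fun x => exists u, x = g u) (s := s) noethR.
- by exists 0; rewrite linear0.
- by exists (r *: u + v); rewrite linearP.
- exact/lin_combE.
have pre v : exists u, v \in t -> g u = v.
  have [vt|] := boolP (v \in t); last by exists 0.
  by have /tP[u ->] := mem_span vt; exists u.
have [l lP] := choice pre; exists [seq l v | v <- t] => x; apply/lin_combE.
have tx : span t (g x) by apply/tP; exists x.
have [y sy /ginj <- //] : exists2 y, span [seq l v | v <- t] y & g y = g x.
apply: (span_sub (S := fun z => exists2 y, span [seq l v | v <- t] y & g y = z))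
  tx => [|r _ _ [y sy <-] [z sz <-]|v vt].
- by exists 0; [apply: span0|rewrite linear0].
- by exists (r *: y + z); [apply: span_linear|rewrite linearP].
by exists (l v); [apply/mem_span/map_f|apply: lP].
Qed.

(** A surjection R^k -> U embeds Hom(U, V) into Hom(R^k, V), a finite sum of
    copies of [V]. *)
Lemma fin_gen_hom (U V : lmodType R) :
  noetherian R -> fin_gen U -> fin_gen V -> fin_gen (hom U V).
Proof.
move=> noethR fgU fgV.
have [k [b bP]] := free_cover (\0 : {linear U -> U}) noethR fgU.
apply: (fin_gen_inj (g := hom_pre V b) noethR).
  move=> f g fg; apply: hom_ext => m; have [v ->] := (bP m).1 erefl.
  exact: (congr1 (fun h : hom _ _ => h v) fg).
apply: (fin_gen_sum (f := fun i => coord_hom V i) fgV) => phi.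
exists (fun i => phi (free_unit R i)); apply: hom_ext => v.
by rewrite hom_sumE free_linearE.
Qed.

End Noetherian.

(** Choose a presentation R^l -> R^k -> M -> 0, with maps [a] and [b].  Both
    sides, as functors of [M], turn it into an exact sequence starting with 0:
    the left side by flatness of [F].  As the map is bijective for R^k and
    injective for R^l, it is bijective for [M] by a diagram chase. *)
Lemma tensor_eval_bij (R : comPzRingType) (M X F : lmodType R) :
  noetherian R -> fin_gen M -> flat F -> bijective (tensor_eval M X F).
Proof.
move=> noethR fgM flatF.
have [k [b bP]] := free_cover (\0 : {linear M -> M}) noethR fgM.
have bsurj m : exists v, b v = m by have [v ->] := (bP m).1 erefl; exists v.
have fgk := fin_gen_free R k.
have [l [a aP]] := free_cover b noethR fgk.
have b_inj : injective (hom_pre X b).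
  move=> f g fg; apply: hom_ext => m; have [v <-] := bsurj m.
  exact: (congr1 (fun h : hom _ _ => h v) fg).
have [psi psiK thetaK] := tensor_eval_free k X F.
apply: linear_bij => [t t0|g].
  apply/(flatF _ _ _ b_inj)/(can_inj psiK).
  by rewrite tensor_eval_pre t0 !linear0.
(* g b comes from Hom(R^k, X) (x) F, and vanishes on the relations R^l. *)
pose h := hom_pre (tensor X F) b g; have hE := thetaK h.
have [t tE] : exists t, psi h = tensor_map F (hom_pre X b) t.
  apply: (flat_exact (g := hom_pre X a)) => //.
    move=> f fa; have [|f' f'E] := factor_surj (g := f) bsurj.
      move=> v /aP[w ->]; exact: (congr1 (fun h : hom _ _ => h w) fa).
    by exists f'; apply: hom_ext => v; rewrite -f'E.
  have [chi chiK _] := tensor_eval_free l X F.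
  apply: (can_inj chiK); rewrite tensor_eval_pre hE linear0.
  apply: hom_ext => w; rewrite -[LHS]/(g (b (a w))).
  have -> : b (a w) = 0 by apply/aP; exists w.
  exact: linear0.
exists t; apply: hom_ext => m; have [v <-] := bsurj m.
have := congr1 (fun h : hom _ _ => h v) hE; rewrite /= tE.
by rewrite tensor_eval_pre.
Qed.

(** * Injective modules *)

Section Injective.
Variable R : comPzRingType.

Definition curry (A F Y : lmodType R) (f : {linear tensor A F -> Y}) :
    {linear A -> hom F Y} :=
  hom_post F f \o @pure_hom R A F.

Lemma curryE (A F Y : lmodType R) (f : {linear tensor A F -> Y}) a y :
  curry f a y = f (pure a y).
Proof. by []. Qed.

(** By adjunction, extending [f] along [g] amounts to extending a map
    A (x) F -> E along g (x) F, and g (x) F is injective. *)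
Lemma injective_flat_hom (E F : lmodType R) :
  injective_module E -> flat F -> injective_module (hom F E).
Proof.
move=> injE flatF A B g f ginj.
have [h hE] := injE _ _ (tensor_map F g) (tensor_lift f) (flatF _ _ _ ginj).
exists (curry h) => a; apply: hom_ext => y.
by rewrite curryE -tensor_mapE hE tensor_liftE.
Qed.

Section Baer.
Variables (T A B : lmodType R) (g : {linear A -> B}) (f : {linear A -> T}).
Hypotheses (noethR : noetherian R) (ginj : injective g).
Hypothesis baerT : forall k (u : {linear free R k -> R^o}) (h : {linear free R k -> T}),
  (forall v, u v = 0 -> h v = 0) ->
  exists h' : {linear R^o -> T}, forall v, h' (u v) = h v.

(** Partial extensions of [f] along [g], encoded by their graphs as submodules
    of B * T, so that the union of a chain of extensions is just a union of
    sets. *)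
Definition functional_graph (G : B * T -> Prop) : Prop :=
  [/\ forall a, G (g a, f a),
      forall r b t c u, G (b, t) -> G (c, u) -> G (r *: b + c, r *: t + u)
    & forall t, G (0, t) -> t = 0].

Definition base_graph (z : B * T) : Prop := exists a, z = (g a, f a).

Lemma base_graph_functional : functional_graph base_graph.
Proof.
split=> [a|r b t c u [a [-> ->]] [a' [-> ->]]|t [a [/esym a0 ->]]].
- by exists a.
- by exists (r *: a + a'); rewrite !linearP.
suff -> : a = 0 by rewrite linear0.
by apply: ginj; rewrite a0 linear0.
Qed.

Lemma functional_graph_uniq G b t u :
  functional_graph G -> G (b, t) -> G (b, u) -> t = u.
Proof.
move=> [_ Glin Gfun] bt bu; apply/eqP; rewrite -subr_eq0; apply/eqP/Gfun.
have := Glin (-1) _ _ _ _ bu bt; rewrite !scaleN1r addNr.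
by rewrite [- u + t]addrC.
Qed.

(** The ideal I of those r with r x in the domain of [G] is generated by the
    entries of a finite list [s].  The hypothesis on [T], applied to the map
    [u] from a free module onto I, yields the element h' 1 of [T] such that
    sending x to h' 1 is compatible with [G]. *)
Lemma functional_graph_extend G x :
  functional_graph G -> exists2 G', functional_graph G' &
    (forall z, G z -> G' z) /\ exists t, G' (x, t).
Proof.
move=> fG; have [G0 Glin Gfun] := fG.
have G00 : G (0, 0) by have := G0 0; rewrite !linear0.
have GZ r b t : G (b, t) -> G (r *: b, r *: t).
  by move=> bt; have := Glin r _ _ _ _ bt G00; rewrite !addr0.
have Guniq := functional_graph_uniq fG.
pose I : {pred R^o} := [pred r : R^o | `[< exists t, G (r *: x, t) >]].
have Icl : submod_closed I.
  split=> [|r a b]; first by apply/asboolP; exists 0; rewrite scale0r.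
  move=> /asboolP[t at_] /asboolP[u bu]; apply/asboolP; exists (r *: t + u).
  by rewrite scalerDl -scalerA; apply: Glin.
have [s sP] := noethR Icl.
pose u := free_map (fun i : 'I_(size s) => s`_i : R^o).
have uI v : u v \in I by apply/sP; exists v.
have uG v : exists t, G ((u v : R) *: x, t) by have /asboolP := uI v.
have [h hP] := choice uG.
have lin : linear h.
  move=> r v w; apply: Guniq (hP _) _.
  by rewrite linearP scalerDl -scalerA; apply: Glin.
have [|h' h'E] := baerT (u := u) (h := mk_linear lin).
  by move=> v uv; apply: Gfun; have := hP v; rewrite uv scale0r.
pose G' z := exists b t (r : R), G (b, t) /\ z = (b + r *: x, t + r *: h' 1).
exists G'; last split.
- split=> [a|r b t c t' [b1 [t1 [r1 [G1 [-> ->]]]]] [b2 [t2 [r2 [G2 [-> ->]]]]]|].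
  + by exists (g a), (f a), 0; rewrite !scale0r !addr0.
  + exists (r *: b1 + b2), (r *: t1 + t2), (r * r1 + r2).
    split; first exact: Glin.
    by rewrite !scalerDr !scalerDl !scalerA; congr (_, _); rewrite addrACA.
  move=> t [b [t1 [r [bt [/esym/eqP b0 ->]]]]].
  have bE : b = - (r *: x) by apply/eqP; rewrite -addr_eq0.
  have Gr : G (r *: x, - t1).
    by rewrite -[r *: x]opprK -bE -!scaleN1r; apply: GZ.
  have /sP[a rE] : (r : R^o) \in I by apply/asboolP; exists (- t1).
  have {}rE : r = u (finfun a).
    by rewrite rE; apply: eq_bigr => i _; rewrite ffunE.
  have := h'E (finfun a); rewrite -rE => rh.
  have -> : r *: h' 1 = - t1.
    rewrite -linearZ (_ : r *: (1 : R^o) = r); last exact: mulr1.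
    rewrite rh; apply: Guniq Gr; rewrite {1}rE; exact: hP.
  by rewrite subrr.
- move=> [b t] bt; exists b, t, 0; by rewrite !scale0r !addr0.
by exists (h' 1), 0, 0, 1; rewrite !scale1r !add0r.
Qed.

(** Baer's criterion: a maximal partial extension, which exists by Zorn's lemma,
    is defined everywhere, since one more element can always be added to its
    domain.  Over a noetherian ring it is enough to test finitely generated
    ideals, here given as images of maps u : R^k -> R. *)
Lemma baer_criterion : exists h : {linear B -> T}, forall a, h (g a) = f a.
Proof.
(* Adding the base graph makes the union of the empty chain admissible. *)
pose ext (G : set (B * T)) z := G z \/ base_graph z.
pose P (G : set (B * T)) := functional_graph (ext G).
have [S SP tot|G [PG Gmax]] := @Zorn_bigcup _ P.
  pose U z := (\bigcup_(G in S) G)%classic z \/ base_graph z.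
  suff : functional_graph U by [].
  have member G : S G -> functional_graph (ext G) /\
      forall z, ext G z -> U z.
    move=> SG; split=> [|z [Gz|]]; [exact: SP|by left; exists G|by right].
  (* Two elements of the union of a chain lie in a common admissible graph. *)
  have pick z w : U z -> U w -> exists2 H,
      functional_graph H /\ (forall z, H z -> U z) & H z /\ H w.
    move=> [[G SG Gz]|bz] [[G' SG' Gw]|bw].
    + have [le|le] := tot G G' SG SG'.
        by exists (ext G'); [exact: (member G' SG')|split; left; [apply: le|]].
      by exists (ext G); [exact: (member G SG)|split; left; [|apply: le]].
    + by exists (ext G); [exact: (member G SG)|split; [left|right]].
    + by exists (ext G'); [exact: (member G' SG')|split; [right|left]].
    by exists base_graph; split=> //; [apply: base_graph_functional|right].
  split=> [a|r b t c u Ub Uc|t Ut]; first by right; exists a.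
    have [H [[_ lin _] HU] [Hb Hc]] := pick _ _ Ub Uc.
    by apply: HU; apply: lin.
  by have [H [[_ _ fn] _] [Ht _]] := pick _ _ Ut Ut; apply: fn.
pose H := ext G.
have total x : exists t, H (x, t).
  have [G' fG' [GG' [t xt]]] := functional_graph_extend x PG.
  exists t; left; apply: contrapT => nxt; apply: (Gmax G').
    by split=> [z Gz|G'G]; [apply: GG'; left|apply/nxt/G'G].
  rewrite /P (_ : ext G' = G') //; apply: funext => z; apply: propext.
  split=> [[//|[a ->]]|]; last by left.
  by have [] := fG'.
have [h hP] := choice total.
have [H0 Hlin _] := PG.
have Huniq := functional_graph_uniq PG.
have lin : linear h.
  by move=> r x y; exact: (Huniq _ _ _ (hP _) (Hlin _ _ _ _ _ (hP _) (hP _))).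
by exists (mk_linear lin) => a; apply: Huniq (hP _) _; apply: H0.
Qed.
End Baer.

(** With the syzygies R^l -> R^k of the generators of an ideal, Baer's criterion
    for a module T asks for exactness of
    Hom(R, T) -> Hom(R^k, T) -> Hom(R^l, T) in the middle.  For T = E (x) F
    this sequence is, in its last two terms, the sequence for E tensored with
    the flat module [F]. *)
Lemma injective_tensor_flat (E F : lmodType R) :
  noetherian R -> injective_module E -> flat F -> injective_module (tensor E F).
Proof.
move=> noethR injE flatF A B g f ginj; apply: (baer_criterion f noethR ginj) => k u h ker.
have [l [a aP]] := free_cover u noethR (fin_gen_free R k).
have [psi psiK thetaK] := tensor_eval_free k E F.
have [chi chiK _] := tensor_eval_free l E F.
have hE := thetaK (h : hom _ _).
have [t tE] : exists t, psi h = tensor_map F (hom_pre E u) t.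
  apply: (flat_exact (g := hom_pre E a)) => //.
    by apply: injective_hom_exact => // v /aP.
  apply: (can_inj chiK); rewrite tensor_eval_pre hE linear0.
  apply: hom_ext => w; apply: ker; apply/aP; by exists w.
exists (tensor_eval R^o E F t) => v.
by rewrite -hE tE tensor_eval_pre.
Qed.
End Injective.

(** * Cohomology *)

Section Cohomology.
Variable R : comPzRingType.
Implicit Types Z : cochain R.

Definition coh_class Z n : {linear cocycle Z n -> cohomology Z n} :=
  quot_proj (@coboundary_closed R Z n).

Lemma coh_class_surj Z n c : exists x, coh_class Z n x = c.
Proof. exact: quot_proj_surj. Qed.

Lemma coh_class0 Z n x : coh_class Z n x = 0 <-> is_coboundary (val x).
Proof.
rewrite -(linear0 (coh_class Z n)) quot_projP subr0.
by split=> /asboolP.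
Qed.

Lemma cocycle_valP Z n (x : cocycle Z n) : cochain_d Z n (val x) = 0.
Proof. exact/eqP/(cocycleP x). Qed.

Lemma is_coboundary0 Z n : is_coboundary (0 : Z n).
Proof. by case: n => //= n; exists 0; rewrite linear0. Qed.

Lemma is_coboundaryB Z n (x y : Z n) :
  is_coboundary x -> is_coboundary y -> is_coboundary (x - y).
Proof.
case: n x y => [|n] x y /=; first by move=> -> ->; rewrite subr0.
by move=> [u ->] [v ->]; exists (u - v); rewrite linearB.
Qed.

(** A criterion for a module [U] to be a cohomology module when it is presented
    as a quotient of [K] rather than of the module of cocycles. *)
Lemma cohomology_isoP Z n (K U : lmodType R) (p : {linear K -> U})
    (j : {linear K -> Z n}) :
  (forall u, exists x, p x = u) -> (forall x, cochain_d Z n (j x) = 0) ->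
  (forall z, cochain_d Z n z = 0 -> exists x, is_coboundary (z - j x)) ->
  (forall x, p x = 0 <-> is_coboundary (j x)) ->
  isomorphic U (cohomology Z n).
Proof.
move=> sp dj sj ker; have jP x : j x \in cocycle_pred (Z := Z) (n := n).
  by rewrite inE dj.
pose c x := Cocycle (jP x).
have lin : linear c by move=> r x y; apply: val_inj; rewrite /= linearP.
pose q := [the {linear K -> _} of coh_class Z n \o mk_linear lin].
have qE x : q x = coh_class Z n (c x) by [].
apply: (isomorphic_same_kernel (p := p) (q := q)) => [//|v|x].
  have [z <-] := coh_class_surj v; have [x xz] := sj _ (cocycle_valP z).
  exists x; apply/eqP; rewrite eq_sym -subr_eq0 qE -linearB; apply/eqP.
  exact/coh_class0.
by rewrite qE coh_class0 ker.
Qed.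

Lemma cochain_map_coboundary Z Z' (f : forall n, {linear Z n -> Z' n}) n x :
  (forall n x, f n.+1 (cochain_d Z n x) = cochain_d Z' n (f n x)) ->
  is_coboundary x -> is_coboundary (f n x).
Proof.
move=> fd; case: n x => [|n] x /=; first by move=> ->; rewrite linear0.
by move=> [y ->]; exists (f n y); rewrite fd.
Qed.

(** Only the values on cocycles in the degree [n] are compared, so that no
    homotopy in the other degrees has to be given. *)
Lemma cohomology_equiv Z Z' (f : forall n, {linear Z n -> Z' n})
    (g : forall n, {linear Z' n -> Z n}) n :
  (forall n x, f n.+1 (cochain_d Z n x) = cochain_d Z' n (f n x)) ->
  (forall n x, g n.+1 (cochain_d Z' n x) = cochain_d Z n (g n x)) ->
  (forall x, cochain_d Z n x = 0 -> is_coboundary (x - g n (f n x))) ->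
  (forall x, cochain_d Z' n x = 0 -> is_coboundary (x - f n (g n x))) ->
  isomorphic (cohomology Z n) (cohomology Z' n).
Proof.
move=> fd gd gf fg.
have vlin : linear (fun x : cocycle Z n => f n (val x)).
  by move=> r x y; rewrite -linearP.
apply: (cohomology_isoP (p := coh_class Z n) (j := mk_linear vlin)).
- exact: coh_class_surj.
- by move=> x; rewrite -fd cocycle_valP linear0.
- move=> z dz; have dgz : cochain_d Z n (g n z) = 0 by rewrite -gd dz linear0.
  have gzP : g n z \in cocycle_pred (Z := Z) (n := n) by rewrite inE dgz.
  by exists (Cocycle gzP); apply: fg.
move=> x; rewrite coh_class0; split=> [|fx]; first exact: cochain_map_coboundary.
(* x = (x - g (f x)) + g (f x), where both terms are coboundaries. *)
rewrite -[val x](subrK (g n (f n (val x)))) -[X in _ + X]opprK.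
apply: is_coboundaryB; first exact/gf/cocycle_valP.
rewrite -sub0r; apply: is_coboundaryB; last exact: cochain_map_coboundary fx.
exact: is_coboundary0.
Qed.

Lemma cohomology_iso Z Z' (f : forall n, {linear Z n -> Z' n}) n :
  (forall n, bijective (f n)) ->
  (forall n x, f n.+1 (cochain_d Z n x) = cochain_d Z' n (f n x)) ->
  isomorphic (cohomology Z n) (cohomology Z' n).
Proof.
move=> bf fd; pose g n := sval (cid (linear_inverse (bf n))).
have gP m : cancel (f m) (g m) /\ cancel (g m) (f m) by rewrite /g; case: cid.
apply: (cohomology_equiv fd (g := g)) => [m x|x _|x _].
- by have [gK fK] := gP m.+1; rewrite -[X in cochain_d _ _ X](gP m).2 -fd gK.
- by rewrite (gP n).1 subrr; apply: is_coboundary0.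
by rewrite (gP n).2 subrr; apply: is_coboundary0.
Qed.

Section TensorCochain.
Variables (Z : cochain R) (F : lmodType R).

Fact tensor_cochain_dd n (x : tensor (Z n) F) :
  tensor_map F (cochain_d Z n.+1) (tensor_map F (cochain_d Z n) x) = 0.
Proof.
rewrite (tensor_map_comp (h := \0)); first exact: tensor_map0.
by move=> a; rewrite cochain_dd.
Qed.
Definition tensor_cochain : cochain R := Cochain tensor_cochain_dd.

(** A uniform description of the coboundaries, by the zero map in degree 0.  It
    spares a case distinction on the degree when tensoring. *)
Lemma coboundary_source n : exists (B : lmodType R) (b : {linear B -> Z n}),
  (forall x, is_coboundary x <-> exists y, x = b y) /\
  (forall x : tensor_cochain n, is_coboundary x <-> exists y, x = tensor_map F b y).
Proof.
case: n => [|n]; last by exists (Z n), (cochain_d Z n); split=> x; split.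
exists (Z 0), \0; split=> x /=; split=> [->|[y ->]] //; try by exists 0.
  by exists 0; rewrite linear0.
exact: tensor_map0.
Qed.

(** Let K be the module of cocycles.  By flatness K (x) F is the module of
    cocycles of Z (x) F, and by right exactness the kernel of
    K (x) F -> H (x) F is the image of B (x) F, that is, the module of
    coboundaries of Z (x) F. *)
Lemma tensor_cohomology n :
  flat F ->
  isomorphic (tensor (cohomology Z n) F) (cohomology tensor_cochain n).
Proof.
move=> flatF; have [B [b [bP bFP]]] := coboundary_source n.
have vlin : linear (fun x : cocycle Z n => val x) by move=> r x y.
pose iota : {linear cocycle Z n -> Z n} := mk_linear vlin.
have iota_inj : injective iota by apply: val_inj.
have bz y : b y \in cocycle_pred (Z := Z) (n := n).
  have : is_coboundary (b y) by apply/bP; exists y.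
  case: (n) (b y) => [|m] x /=; rewrite inE; first by move=> ->; rewrite linear0.
  by move=> [u ->]; rewrite cochain_dd.
have clin : linear (fun y => Cocycle (bz y)).
  by move=> r x y; apply: val_inj; rewrite /= linearP.
(* b, with its values regarded as cocycles *)
pose c : {linear B -> cocycle Z n} := mk_linear clin.
have cE y : iota (c y) = b y by [].
apply: (cohomology_isoP (Z := tensor_cochain) (n := n)
  (p := tensor_map F (coh_class Z n))
  (j := tensor_map F iota)).
- exact/tensor_map_surj/coh_class_surj.
- move=> x; rewrite /= (tensor_map_comp (h := \0)) ?tensor_map0 // => y.
  exact: cocycle_valP.
- move=> z dz; have [|x ->] := flat_exact (f := iota) flatF _ dz.
    move=> y dy; have yP : y \in cocycle_pred (Z := Z) (n := n) by rewrite inE dy.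
    by exists (Cocycle yP).
  by exists x; rewrite subrr; apply/bFP; exists 0; rewrite linear0.
move=> x; split=> [x0|/bFP[y]].
  have [||u ->] := tensor_right_exact (f := c) _ _ x0.
  - exact: coh_class_surj.
  - move=> y /coh_class0/bP[w wE]; exists w; exact: val_inj.
  by apply/bFP; exists u; rewrite (tensor_map_comp cE).
rewrite -(tensor_map_comp cE) => /(flatF _ _ _ iota_inj) ->.
rewrite (tensor_map_comp (h := \0)) ?tensor_map0 // => w.
by apply/coh_class0/bP; exists w.
Qed.
End TensorCochain.

Lemma tensor_isomorphic (U V F : lmodType R) :
  isomorphic U V -> isomorphic (tensor U F) (tensor V F).
Proof.
move=> [f /linear_inverse[g [fK gK]]].
have tid (W : lmodType R) (h : {linear W -> W}) t :
    (forall w, h w = w) -> tensor_map F h t = t.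
  move=> hid; rewrite -[RHS]/(idfun t); apply: tensor_ext => w y.
  by rewrite tensor_mapE hid.
exists (tensor_map F f), (tensor_map F g) => t.
  by rewrite (tensor_map_comp (h := idfun)) ?tid.
by rewrite (tensor_map_comp (h := idfun)) ?tid.
Qed.
End Cohomology.

(** * The comparison theorem *)

Section Category.
Variable R : comPzRingType.

(** Categories enriched in R-modules, so that the comparison theorem can be
    applied both to modules and to the opposite category. *)
Record linear_category := LinearCategory {
  cat_obj :> Type;
  cat_hom : cat_obj -> cat_obj -> lmodType R;
  cat_id : forall X, cat_hom X X;
  cat_comp : forall X Y Z, cat_hom Y Z -> cat_hom X Y -> cat_hom X Z;
  cat_compA : forall X Y Z W (h : cat_hom Z W) (g : cat_hom Y Z)
    (f : cat_hom X Y), cat_comp h (cat_comp g f) = cat_comp (cat_comp h g) f;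
  cat_idl : forall X Y (f : cat_hom X Y), cat_comp (cat_id Y) f = f;
  cat_idr : forall X Y (f : cat_hom X Y), cat_comp f (cat_id X) = f;
  cat_linl : forall X Y Z (f : cat_hom X Y),
    linear (fun g : cat_hom Y Z => cat_comp g f);
  cat_linr : forall X Y Z (g : cat_hom Y Z),
    linear (fun f : cat_hom X Y => cat_comp g f) }.

Definition opposite (A : linear_category) : linear_category.
Proof.
refine (@LinearCategory A (fun X Y => cat_hom Y X) (@cat_id A)
  (fun X Y Z g f => cat_comp f g) _ _ _ _ _).
- by move=> *; rewrite cat_compA.
- by move=> *; rewrite cat_idr.
- by move=> *; rewrite cat_idl.
- by move=> *; apply: cat_linr.
by move=> *; apply: cat_linl.
Defined.

Definition modules : linear_category.
Proof.
refine (@LinearCategory (lmodType R) (fun U V => hom U V)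
  (fun U => [the {linear U -> U} of idfun]) (fun U V W g f => hom_post U g f)
  _ _ _ _ _).
- by move=> *; apply: hom_ext.
- by move=> *; apply: hom_ext.
- by move=> *; apply: hom_ext.
- by move=> U V W f r g h; apply: hom_ext.
by move=> *; apply: linearP.
Defined.

Section Comparison.
Variable A : linear_category.
Local Notation "g \oc f" := (cat_comp g f) (at level 40, left associativity).

Lemma cat_compBl (X Y Z : A) (g h : cat_hom Y Z) (f : cat_hom X Y) :
  (g - h) \oc f = g \oc f - h \oc f.
Proof. exact: (linearB (mk_linear (cat_linl f)) g h). Qed.
Lemma cat_compBr (X Y Z : A) (g : cat_hom Y Z) (f h : cat_hom X Y) :
  g \oc (f - h) = g \oc f - g \oc h.
Proof. exact: (linearB (mk_linear (cat_linr g)) f h). Qed.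
Lemma cat_compDr (X Y Z : A) (g : cat_hom Y Z) (f h : cat_hom X Y) :
  g \oc (f + h) = g \oc f + g \oc h.
Proof. exact: (linearD (mk_linear (cat_linr g)) f h). Qed.
Lemma cat_comp0l (X Y Z : A) (f : cat_hom X Y) : (0 : cat_hom Y Z) \oc f = 0.
Proof. exact: (linear0 (mk_linear (cat_linl f))). Qed.
Lemma cat_comp0r (X Y Z : A) (g : cat_hom Y Z) : g \oc (0 : cat_hom X Y) = 0.
Proof. exact: (linear0 (mk_linear (cat_linr g))). Qed.

Record complex := Complex {
  cx_obj :> nat -> A;
  cx_d : forall n, cat_hom (cx_obj n.+1) (cx_obj n);
  cx_dd : forall n, cx_d n \oc cx_d n.+1 = 0 }.

(** Exactness of Hom(W, X).  The term of index 0 is the resolved object, so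
    exactness at 0 says that all maps from [W] to it lift. *)
Definition exact_on (W : A) (X : complex) : Prop :=
  (forall f : cat_hom W (X 0%N), exists g, f = cx_d X 0 \oc g) /\
  (forall n (f : cat_hom W (X n.+1)), cx_d X n \oc f = 0 ->
     exists g, f = cx_d X n.+1 \oc g).

(** Dependent choice, with an invariant [Q] that guarantees that the next step
    is possible. *)
Lemma dependent_recursion (T : nat -> Type) (Q : forall n, T n -> Prop)
    (P : forall n, T n -> T n.+1 -> Prop) (x0 : T 0%N) :
  Q 0%N x0 -> (forall n x, Q n x -> exists y, P n x y /\ Q n.+1 y) ->
  exists2 f : forall n, T n, f 0%N = x0 & forall n, P n (f n) (f n.+1).
Proof.
move=> Q0 step.
have stepT n (x : {x | Q n x}) : {y : {y | Q n.+1 y} | P n (sval x) (sval y)}.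
  case: x => x Qx; have /cid[y [Pxy Qy]] := step n x Qx.
  by exists (exist _ y Qy).
pose fix s n : {x | Q n x} := if n is m.+1 then sval (stepT m (s m)) else exist _ x0 Q0.
by exists (fun n => sval (s n)) => // n /=; case: (stepT n (s n)).
Qed.

(** The invariant of the construction is that d f_n d = 0 in each positive
    degree n: it is what exactness of [Y] requires in order to lift f_n d. *)
Lemma comparison (X Y : complex) (u : cat_hom (X 0%N) (Y 0%N)) :
  (forall n, exact_on (X n.+1) Y) ->
  exists2 f : forall n, cat_hom (X n) (Y n), f 0%N = u &
    forall n, cx_d Y n \oc f n.+1 = f n \oc cx_d X n.
Proof.
move=> ex.
pose Q n : cat_hom (X n) (Y n) -> Prop :=
  if n is m.+1 then fun f => cx_d Y m \oc f \oc cx_d X m.+1 = 0 else fun _ => True.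
apply: (dependent_recursion (Q := Q)
  (P := fun n f g => cx_d Y n \oc g = f \oc cx_d X n)) => // n f Qf.
have [g gE] : exists g, f \oc cx_d X n = cx_d Y n \oc g.
  case: n f Qf => [|n] f Qf; first exact: (ex 0%N).1.
  by apply: (ex n.+1).2; rewrite cat_compA.
exists g; split=> //=; by rewrite -gE -cat_compA cx_dd cat_comp0r.
Qed.

(** A chain map that vanishes in degree 0 is null homotopic.  The invariant
    d (f_(n+1) - s_n d) = 0 allows f_(n+1) - s_n d to be lifted through the
    differential of [Y]. *)
Lemma comparison_homotopy (X Y : complex) (f : forall n, cat_hom (X n) (Y n)) :
  (forall n, exact_on (X n.+1) Y) ->
  (forall n, cx_d Y n \oc f n.+1 = f n \oc cx_d X n) -> f 0%N = 0 ->
  exists2 s : forall n, cat_hom (X n) (Y n.+1), s 0%N = 0 &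
    forall n, f n.+1 = cx_d Y n.+1 \oc s n.+1 + s n \oc cx_d X n.
Proof.
move=> ex fd f0.
apply: (dependent_recursion
  (Q := fun n s => cx_d Y n \oc (f n.+1 - s \oc cx_d X n) = 0)
  (P := fun n s t => f n.+1 = cx_d Y n.+1 \oc t + s \oc cx_d X n)) => [|n s Qs].
  by rewrite cat_comp0l subr0 fd f0 cat_comp0l.
have [t tE] := (ex n).2 n _ Qs; exists t; rewrite -tE subrK; split=> //.
rewrite cat_compBr cat_compA -tE cat_compBl fd -!cat_compA cx_dd cat_comp0r.
by rewrite subr0 subrr.
Qed.

Section Represented.
Variables (X : complex) (N : A).

Definition represented_d n :
    {linear cat_hom (X n.+1) N -> cat_hom (X n.+2) N} :=
  mk_linear (cat_linl (Z := N) (cx_d X n.+1)).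
Fact represented_dd n (x : cat_hom (X n.+1) N) :
  represented_d n.+1 (represented_d n x) = 0.
Proof. by rewrite /= -cat_compA cx_dd cat_comp0r. Qed.
(** The complex Hom(X, N) without the term of the resolved object [X 0], which
    is why the indices are shifted by one. *)
Definition represented : cochain R := Cochain represented_dd.
End Represented.

(** The homotopy s between the identity and g f shows that x - x g f = x s d
    for a cocycle x; in degree 0 this is zero because s starts with 0. *)
Lemma represented_homotopic (X Y : complex) (N : A) n
    (f : forall n, cat_hom (X n) (Y n)) (g : forall n, cat_hom (Y n) (X n))
    (x : represented X N n) :
  (forall n, exact_on (X n.+1) X) ->
  (forall n, cx_d Y n \oc f n.+1 = f n \oc cx_d X n) ->
  (forall n, cx_d X n \oc g n.+1 = g n \oc cx_d Y n) ->
  g 0%N \oc f 0%N = cat_id _ -> cochain_d (represented X N) n x = 0 ->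
  is_coboundary (x - x \oc g n.+1 \oc f n.+1 : represented X N n).
Proof.
move=> ex fd gd gf dx.
have [n'||s s0 sE] := comparison_homotopy
  (f := fun n => cat_id (X n) - g n \oc f n) ex.
- rewrite cat_compBr cat_compBl cat_idr cat_idl; congr (_ - _).
  by rewrite cat_compA gd -!cat_compA fd.
- by rewrite gf subrr.
have -> : x - x \oc g n.+1 \oc f n.+1 = x \oc s n \oc cx_d X n.
  rewrite -[X in X - _]cat_idr -cat_compA -cat_compBr sE cat_compDr !cat_compA.
  by rewrite [x \oc _](dx : _ = 0) cat_comp0l add0r.
case: n x {dx} => [|n] x; last by exists (x \oc s n.+1).
by rewrite s0 cat_comp0r cat_comp0l.
Qed.

(** The comparison maps between [X] and [Y] that extend [u] and [v] are inverse
    to each other up to homotopy.  The class [W] has to contain the terms of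
    both complexes, as the maps and the homotopies start from either of
    them. *)
Lemma cohomology_comparison (W : A -> Prop) (X Y : complex) (N : A) i
    (u : cat_hom (X 0%N) (Y 0%N)) (v : cat_hom (Y 0%N) (X 0%N)) :
  u \oc v = cat_id _ -> v \oc u = cat_id _ ->
  (forall n, W (X n.+1)) -> (forall n, W (Y n.+1)) ->
  (forall V, W V -> exact_on V X) -> (forall V, W V -> exact_on V Y) ->
  isomorphic (cohomology (represented X N) i) (cohomology (represented Y N) i).
Proof.
move=> uv vu WX WY exX exY.
have [f f0 fd] := comparison u (fun n => exY _ (WX n)).
have [g g0 gd] := comparison v (fun n => exX _ (WY n)).
apply: (cohomology_equiv (Z := represented X N) (Z' := represented Y N)
  (f := fun n => mk_linear (cat_linl (Z := N) (g n.+1)))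
  (g := fun n => mk_linear (cat_linl (Z := N) (f n.+1)))) => [n x|n x|x dx|x dx] /=.
- by rewrite -!cat_compA gd.
- by rewrite -!cat_compA fd.
- apply: represented_homotopic => // [n|]; [exact/exX/WX|by rewrite f0 g0].
- apply: represented_homotopic => // [n|]; [exact/exY/WY|by rewrite f0 g0].
Qed.
End Comparison.
End Category.

(** * Resolutions by finitely generated modules *)

Section FinGenResolution.
Variable R : comPzRingType.
Variable C : lmodType R.
Hypotheses (noethR : noetherian R) (fgC : fin_gen C).

(** The last differential built so far.  Its source is the module to be covered
    next and has to be finitely generated for the construction to go on. *)
Record stage := Stage {
  stage_src : lmodType R;
  stage_tgt : lmodType R;
  stage_map : {linear stage_src -> stage_tgt};
  stage_fg : fin_gen stage_src }.

(** The cycles for Hom(C, -), covered by a free module of finite rank; by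
    adjunction the cover is a map R^k (x) C -> G_n. *)
Lemma next_cover (s : stage) : exists k (u : {linear free R k -> hom C (stage_src s)}),
  forall f, hom_post C (stage_map s) f = 0 <-> exists r, f = u r.
Proof. exact/free_cover/fin_gen_hom/stage_fg. Qed.

Definition next_rank s : nat := sval (cid (next_cover s)).
Definition next_gens s : {linear free R (next_rank s) -> hom C (stage_src s)} :=
  sval (cid (svalP (cid (next_cover s)))).

Lemma next_gensP s f :
  hom_post C (stage_map s) f = 0 <-> exists r, f = next_gens s r.
Proof. exact: (svalP (cid (svalP (cid (next_cover s)))) f). Qed.

Definition next_stage s : stage :=
  Stage (tensor_lift (next_gens s)) (fin_gen_tensor_free (next_rank s) fgC).

Lemma next_stage_dd s x : stage_map s (stage_map (next_stage s) x) = 0.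
Proof.
rewrite -[RHS]/((\0 : {linear _ -> _}) x).
rewrite -[LHS]/((stage_map s \o stage_map (next_stage s)) x).
apply: tensor_ext => v c.
rewrite -[LHS]/(stage_map s (tensor_lift (next_gens s) (pure v c))) tensor_liftE.
have /next_gensP e : exists r, next_gens s v = next_gens s r by exists v.
exact: (congr1 (fun h : hom _ _ => h c) e).
Qed.

(** For Y = P (x) C, a cycle f corresponds to a map from the projective module P
    to the image of [next_gens s], and lifts to the free module. *)
Lemma next_stage_exact s Y (f : hom Y (stage_src s)) :
  class_PC C Y -> hom_post Y (stage_map s) f = 0 ->
  exists g, f = hom_post Y (stage_map (next_stage s)) g.
Proof.
move=> [P projP [i [i' iK i'K]]] df.
have [j [jK Kj]] : exists j : {linear tensor P C -> Y}, cancel i j /\ cancel j i.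
  by apply: linear_inverse; exists i'.
pose h := curry [the {linear _ -> _} of f \o j].
have [|l lE] := projective_lift (g := next_gens s) (f := h) projP.
  move=> p; apply/next_gensP; apply: hom_ext => c.
  exact: (congr1 (fun h : hom _ _ => h (j (pure p c))) df).
exists [the {linear _ -> _} of tensor_map C l \o i].
apply: hom_ext => y; rewrite -[in LHS](jK y) -[RHS]/((tensor_lift _ \o tensor_map C l) (i y)).
rewrite -[LHS]/((f \o j) (i y)); apply: tensor_ext => p c.
rewrite -[RHS]/(tensor_lift (next_gens s) (tensor_map C l (pure p c))).
by rewrite tensor_mapE tensor_liftE lE.
Qed.

Variables (M : lmodType R) (fgM : fin_gen M).

(** The construction starts with the zero map on [M]: then every map to [M] is a
    cycle, and the first step covers Hom(C, M) itself. *)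
Definition resolution_stage n : stage :=
  iter n next_stage (Stage (\0 : {linear M -> M}) fgM).

Fact fg_resolution_dd n :
  @cat_comp R (modules R) _ _ _ (stage_map (resolution_stage n.+1) : hom _ _)
    (stage_map (resolution_stage n.+2) : hom _ _) = 0.
Proof. by apply: hom_ext => x; apply: (@next_stage_dd (resolution_stage n.+1)). Qed.

Definition fg_resolution : complex (modules R) :=
  @Complex R (modules R) (fun n => stage_src (resolution_stage n))
    (fun n => stage_map (resolution_stage n.+1))
    fg_resolution_dd.

Lemma fg_resolution_fg n : fin_gen (fg_resolution n : lmodType R).
Proof. exact: stage_fg. Qed.

Lemma fg_resolution_PC n : class_PC C (fg_resolution n.+1).
Proof.
exists (free R (next_rank (resolution_stage n))); first exact: projective_free.
exact: isomorphic_refl.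
Qed.

Lemma fg_resolution_exact Y : class_PC C Y -> @exact_on R (modules R) Y fg_resolution.
Proof.
move=> YC; split=> [f|n f df].
  by apply: (@next_stage_exact (resolution_stage 0) Y f YC); apply: hom_ext.
exact: (@next_stage_exact (resolution_stage n.+1) Y f YC df).
Qed.
End FinGenResolution.

(** * The relative Ext modules *)

Section RelativeExt.
Variable R : comPzRingType.

Fact chain_complex_dd (X : chain R) n :
  @cat_comp R (modules R) _ _ _ (chain_d X n : hom _ _) (chain_d X n.+1 : hom _ _) = 0.
Proof. by apply: hom_ext => x; apply: chain_dd. Qed.

Definition chain_complex (X : chain R) : complex (modules R) :=
  @Complex R (modules R) X (fun n => chain_d X n)
    (chain_complex_dd X).

Fact cochain_complex_dd (Z : cochain R) n :
  @cat_comp R (opposite (modules R)) _ _ _ (cochain_d Z n : hom _ _)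
    (cochain_d Z n.+1 : hom _ _) = 0.
Proof. by apply: hom_ext => x; apply: cochain_dd. Qed.

Definition cochain_complex (Z : cochain R) : complex (opposite (modules R)) :=
  @Complex R (opposite (modules R)) Z (fun n => cochain_d Z n)
    (cochain_complex_dd Z).

Lemma Ext_PCM_represented (C M N : lmodType R) (L : proper_PC_resolution C M) i :
  isomorphic (Ext_PCM L N i)
    (cohomology (represented (chain_complex (chain_aug (@pcr_augd _ _ _ L))) N) i).
Proof.
apply: (@cohomology_iso R (hom_from_chain L N)
  (represented (chain_complex (chain_aug (@pcr_augd _ _ _ L))) N)
  (fun n => [the {linear hom (L n) N -> hom (L n) N} of idfun])) => [n|n x].
  by exists idfun.
by [].
Qed.

Lemma Ext_MIC_represented (C M N : lmodType R) (J : proper_IC_coresolution C N) i :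
  isomorphic (Ext_MIC M J i)
    (cohomology (represented (cochain_complex (cochain_aug (@icr_augd _ _ _ J))) M) i).
Proof.
apply: (@cohomology_iso R (hom_to_cochain J M)
  (represented (cochain_complex (cochain_aug (@icr_augd _ _ _ J))) M)
  (fun n => [the {linear hom M (J n) -> hom M (J n)} of idfun])) => [n|n x].
  by exists idfun.
by [].
Qed.

Lemma proper_PC_exact (C M Y : lmodType R) (L : proper_PC_resolution C M) :
  class_PC C Y -> @exact_on R (modules R) Y (chain_complex (chain_aug (@pcr_augd _ _ _ L))).
Proof. by move=> /(pcr_proper L). Qed.

Lemma proper_IC_exact (C N Y : lmodType R) (J : proper_IC_coresolution C N) :
  class_IC C Y ->
  @exact_on R (opposite (modules R)) Y
    (cochain_complex (cochain_aug (@icr_augd _ _ _ J))).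
Proof. by move=> /(icr_proper J). Qed.

(** Both resolutions are replaced by [fg_resolution], whose terms are finitely
    generated. *)
Lemma tensor_Ext_PCM (C M N F : lmodType R) (L L' : proper_PC_resolution C M) i :
  noetherian R -> fin_gen C -> fin_gen M -> flat F ->
  isomorphic (tensor (Ext_PCM L N i) F) (Ext_PCM L' (tensor N F) i).
Proof.
move=> noethR fgC fgM flatF.
pose G := fg_resolution noethR fgC fgM.
have compare (K : proper_PC_resolution C M) (X : lmodType R) :
    isomorphic (Ext_PCM K X i) (cohomology (represented G X) i).
  apply: isomorphic_trans (Ext_PCM_represented _ _ _) _.
  apply: (@cohomology_comparison R (modules R) (class_PC C)
    (chain_complex (chain_aug (@pcr_augd _ _ _ K))) G X i
    [the {linear M -> M} of idfun] [the {linear M -> M} of idfun]).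
  - exact: hom_ext.
  - exact: hom_ext.
  - exact: pcr_PC.
  - exact: fg_resolution_PC.
  - by move=> Y; apply: proper_PC_exact.
  by move=> Y; apply: fg_resolution_exact.
apply: isomorphic_trans (tensor_isomorphic _ (compare L N)) _.
apply: isomorphic_trans (isomorphic_sym (compare L' _)).
apply: isomorphic_trans (tensor_cohomology _ _ flatF) _.
apply: (cohomology_iso (Z := tensor_cochain (represented G N) F)
  (Z' := represented G (tensor N F)) (f := fun n => tensor_eval (G n.+1) N F)).
- by move=> n; apply: tensor_eval_bij => //; apply: fg_resolution_fg.
move=> n x; exact: (@tensor_eval_pre R _ _ N F (cx_d G n.+1 : hom _ _)).
Qed.

Section TensorIC.
Variables (C F : lmodType R).
Hypotheses (noethR : noetherian R) (fgC : fin_gen C) (flatF : flat F).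

(** Hom(C, E) (x) F = Hom(C, E (x) F), and E (x) F is injective. *)
Lemma class_IC_tensor Y : class_IC C Y -> class_IC C (tensor Y F).
Proof.
move=> [E injE YE]; exists (tensor E F); first exact: injective_tensor_flat.
apply: isomorphic_trans (tensor_isomorphic F YE) _.
by exists (tensor_eval C E F); apply: tensor_eval_bij.
Qed.

Section HomSwap.
Variables (A B E : lmodType R) (f : hom A (hom B E)).

Lemma hom_swap_linear1 b : linear (fun a => f a b).
Proof.
move=> r x y; exact: (congr1 (fun h : hom B E => h b) (linearP f r x y)).
Qed.

Lemma hom_swap_linear2 : linear (fun b => mk_linear (hom_swap_linear1 b) : hom A E).
Proof. by move=> r x y; apply: hom_ext => a; apply: (linearP (f a)). Qed.

Definition hom_swap : hom B (hom A E) := mk_linear hom_swap_linear2.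
End HomSwap.

(** Hom(F, Hom(C, E)) = Hom(C, Hom(F, E)), and Hom(F, E) is injective. *)
Lemma class_IC_hom Y : class_IC C Y -> class_IC C (hom F Y).
Proof.
move=> [E injE [i bi]]; exists (hom F E); first exact: injective_flat_hom.
have [j [iK jK]] := linear_inverse bi.
have lin : linear (fun f : hom F Y => hom_swap (hom_post F i f)).
  move=> r f g; apply: hom_ext => c; apply: hom_ext => y.
  by rewrite /= linearP.
exists (mk_linear lin).
exists (fun g => hom_post F j (hom_swap g)) => f.
  by apply: hom_ext => y; rewrite /= -[RHS]iK; congr (j _); apply: hom_ext.
apply: hom_ext => c; apply: hom_ext => y; rewrite /=.
exact: (congr1 (fun h : hom _ _ => h c) (jK (hom_swap f y))).
Qed.

(** By adjunction Hom(Z (x) F, Y) is Hom(Z, Hom(F, Y)), and Hom(F, Y) is again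
    in I_C. *)
Lemma tensor_proper_IC_exact (Z : cochain R) Y :
  class_IC C Y -> (forall Y', class_IC C Y' ->
    @exact_on R (opposite (modules R)) Y' (cochain_complex Z)) ->
  @exact_on R (opposite (modules R)) Y (cochain_complex (tensor_cochain Z F)).
Proof.
move=> YC properZ; have [ex0 exS] := properZ _ (class_IC_hom YC).
have lift_eq n (f : hom (tensor (Z n) F) Y) (g : hom (Z n.+1) (hom F Y)) :
    (curry f : hom _ _) = hom_pre (hom F Y) (cochain_d Z n) g ->
    f = hom_pre Y (tensor_map F (cochain_d Z n)) (tensor_lift g).
  move=> e; apply: hom_ext => t.
  rewrite -[RHS]/((tensor_lift g \o tensor_map F (cochain_d Z n)) t).
  apply: tensor_ext => z y.
  rewrite -[RHS]/(tensor_lift g (tensor_map F (cochain_d Z n) (pure z y))).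
  rewrite tensor_mapE tensor_liftE -curryE.
  exact: (congr1 (fun h : hom _ (hom _ _) => h z y) e).
split=> [f|n f df].
  have [g gE] := ex0 (curry f).
  by exists (tensor_lift g); apply: lift_eq.
have [|g gE] := exS n (curry f).
  apply: hom_ext => z; apply: hom_ext => y.
  rewrite -[LHS]/(f (pure (cochain_d Z n z) y)) -tensor_mapE.
  exact: (congr1 (fun h : hom _ _ => h (pure z y)) df).
by exists (tensor_lift g); apply: lift_eq.
Qed.

(** J (x) F is a proper coresolution of N (x) F, and is compared with [J']. *)
Lemma tensor_Ext_MIC (M N : lmodType R) (J : proper_IC_coresolution C N)
    (J' : proper_IC_coresolution C (tensor N F)) i :
  fin_gen M -> isomorphic (tensor (Ext_MIC M J i) F) (Ext_MIC M J' i).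
Proof.
move=> fgM.
pose X := cochain_complex (tensor_cochain (cochain_aug (@icr_augd _ _ _ J)) F).
apply: isomorphic_trans (tensor_cohomology _ _ flatF) _.
apply: isomorphic_trans (isomorphic_sym (Ext_MIC_represented M J' i)).
apply: (isomorphic_trans (V := cohomology (represented X M) i)).
  apply: (@cohomology_iso R (tensor_cochain (hom_to_cochain J M) F)
    (represented X M) (fun n => tensor_eval M (J n) F)) => [n|n x].
    exact: tensor_eval_bij.
  exact: tensor_eval_post.
apply: (@cohomology_comparison R (opposite (modules R)) (class_IC C)
  X (cochain_complex (cochain_aug (@icr_augd _ _ _ J'))) M i
  [the {linear tensor N F -> tensor N F} of idfun]
  [the {linear tensor N F -> tensor N F} of idfun]).
- exact: hom_ext.
- exact: hom_ext.
- move=> n; exact/class_IC_tensor/(icr_IC J).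
- exact: icr_IC.
- move=> Y YC; apply: tensor_proper_IC_exact => // Y'; exact: proper_IC_exact.
by move=> Y; apply: proper_IC_exact.
Qed.
End TensorIC.
End RelativeExt.

Theorem proposition3p15 (R : comPzRingType) (C M N F : lmodType R) :
  noetherian R -> semidualizing C -> fin_gen M -> flat F ->
  forall i : nat,
    (forall (J : proper_IC_coresolution C N)
            (J' : proper_IC_coresolution C (tensor N F)),
      isomorphic (tensor (Ext_MIC M J i) F) (Ext_MIC M J' i)) /\
    (forall L L' : proper_PC_resolution C M,
      isomorphic (tensor (Ext_PCM L N i) F) (Ext_PCM L' (tensor N F) i)).
Proof.
move=> noethR [fgC _ _] fgM flatF i; split=> [J J'|L L'].
  exact: tensor_Ext_MIC.
exact: tensor_Ext_PCM.
Qed.
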